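(* Let $p$ be an odd prime number, let $k$ be an algebraically closed field of characteristic $p$, and let $1<e_1,e_2,e_3<p$ be integers such that $E:=e_1+e_2+e_3$ is even and $e_3\neq p-1$. Put $d=(E+p-3)/2$, i.e. $\boldsymbol{C}:=(d;e_1,e_2,e_3,p-1)$ is a genus-$0$ ramification type. Then the Hurwitz curve $\mathcal{H}_p(\boldsymbol{C})$ is connected.
   Context: A cover is a finite separable, tamely ramified morphism $f:X\to\mathbb{P}^1_k$ with $X$ a smooth projective connected curve. Branch points are ordered and normalized: $(x_1=0,x_2=1,x_3=\infty,x_4=\lambda)$ with $\lambda\in\mathbb{P}^1_k\setminus\{0,1,\infty\}$. For integers $e_i>1$, a cover has (single-cycle) ramification type $(d;e_1,e_2,e_3,e_4)$ if it has degree $d$, is branched exactly at the four branch points, and for each $i$ the fiber over $x_i$ contains exactly one ramified point, whose ramification index is $e_i$. The type has genus $0$ if $\sum_i(e_i-1)=2d-2$, in which case $X$ has genus $0$. Two covers $f_1:X_1\to\mathbb{P}^1$, $f_2:X_2\to\mathbb{P}^1$ are isomorphic if there is an isomorphism $\iota:X_1\to X_2$ with $f_2\circ\iota=f_1$. The Hurwitz curve $\mathcal{H}_p(\boldsymbol{C})$ is the Hurwitz space over $k$ parameterizing isomorphism classes of covers of ramification type $\boldsymbol{C}$ with branch locus $(0,1,\infty,\lambda)$, $\lambda$ varying; it comes with the natural map $\mathcal{H}_p(\boldsymbol{C})\to\mathbb{P}^1_\lambda\setminus\{0,1,\infty\}$ sending the class of a cover to its fourth branch point $\lambda$. *)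

(* Defs.v *)
From HB Require Import structures.
From mathcomp Require Import all_boot all_order all_algebra.
From mathcomp Require Import all_classical all_reals all_analysis.
From mathcomp Require Import generic_quotient separable.
From mathcomp Require Import (canonicals) mpoly.
Set Implicit Arguments.
Unset Strict Implicit.
Unset Printing Implicit Defensive.
Import GRing.Theory.
Local Open Scope classical_set_scope.
Local Open Scope ring_scope.

(** * The Zariski topology on affine space *)

(* [affine_space k n] is an alias of ['rV[k]_n], so that the Zariski topology
   does not interfere with the entrywise topology of matrices. *)
Definition affine_space (k : fieldType) (n : nat) : Type := 'rV[k]_n.

HB.instance Definition _ (k : fieldType) (n : nat) :=
  Choice.copy (affine_space k n) 'rV[k]_n.

Definition zero_locus (k : fieldType) (n : nat)
    (S : set (mpoly.mpoly n k)) : set (affine_space k n) :=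
  [set v | forall g, S g -> mpoly.meval (fun i => v ord0 i) g = 0].

Definition zariski_open (k : fieldType) (n : nat)
    (U : set (affine_space k n)) : Prop :=
  exists S, U = ~` zero_locus S.

Section ZariskiTopology.
Variables (k : fieldType) (n : nat).
Implicit Types U V : set (affine_space k n).

Lemma zariski_openT : zariski_open (@setT (affine_space k n)).
Proof.
exists [set (1 : mpoly.mpoly n k)]; apply/seteqP; split=> // v _ /(_ 1 erefl) /eqP.
by rewrite mpoly.meval1 oner_eq0.
Qed.

Lemma zariski_openI : setI_closed (@zariski_open k n).
Proof.
move=> _ _ [S ->] [T ->].
exists [set h | exists f g, [/\ S f, T g & h = f * g]].
rewrite -setCU; congr (~` _); apply/seteqP; split=> v.
  by move=> [zS|zT] _ [f [g [Sf Tg ->]]]; rewrite mpoly.mevalM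
    ?(zS f Sf) ?(zT g Tg) ?mul0r ?mulr0.
move=> zST; have [zS|nzS] := pselect (zero_locus S v); [by left|right].
move=> g Tg; have [f Sf fv] : exists2 f, S f &
    mpoly.meval (fun i => (v : 'rV_n) ord0 i) f <> 0.
  apply: contrapT => nex; apply: nzS => f Sf.
  by apply: contrapT => fv; apply: nex; exists f.
have /eqP := zST (f * g) (ex_intro _ f (ex_intro _ g (And3 Sf Tg erefl))).
by rewrite mpoly.mevalM mulf_eq0 => /orP[/eqP|/eqP].
Qed.

Lemma zariski_open_bigU (J : Type) (F : J -> set (affine_space k n)) :
  (forall i, zariski_open (F i)) -> zariski_open (\bigcup_i F i).
Proof.
move=> /choice[S FS]; exists (\bigcup_i S i).
under eq_bigcupr do rewrite FS.
rewrite -setC_bigcap; congr (~` _); apply/seteqP; split=> v.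
  by move=> zv g [i _ Sig]; exact: zv i I g Sig.
by move=> zv i _ g Sig; apply: zv; exists i.
Qed.

HB.instance Definition _ := isOpenTopological.Build (affine_space k n)
  zariski_openT zariski_openI zariski_open_bigU.

End ZariskiTopology.

(** * The projective line and its automorphisms *)

(* [Some a] is the point [a : 1] and [None] is the point at infinity [1 : 0]. *)
Definition proj_line (k : fieldType) : Type := option k.

Definition hom_point (k : fieldType) (u v : k) : proj_line k :=
  if v == 0 then None else Some (u / v).

Definition hom_coord (k : fieldType) (x : proj_line k) : 'cV[k]_2 :=
  \col_i (if x is Some a then if i == ord0 then a else 1
          else (i == ord0)%:R).

Definition moebius (k : fieldType) (A : 'M[k]_2) (x : proj_line k) :
    proj_line k :=
  let w := A *m hom_coord x in hom_point (w ord0 ord0) (w ord_max ord0).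

Section MoebiusAction.
Variable k : fieldType.

Lemma hom_coord_neq0 (x : proj_line k) : hom_coord x != 0.
Proof.
apply/eqP => /matrixP e; case: x e => [a|] e.
  by have /eqP := e ord_max ord0; rewrite !mxE /= oner_eq0.
by have /eqP := e ord0 ord0; rewrite !mxE /= oner_eq0.
Qed.

Lemma hom_pointK (x : proj_line k) :
  hom_point (hom_coord x ord0 ord0) (hom_coord x ord_max ord0) = x.
Proof.
by rewrite /hom_point !mxE; case: x => [a|] /=; rewrite ?oner_eq0 ?divr1 ?eqxx.
Qed.

Lemma hom_pointZ (c u v : k) : c != 0 ->
  hom_point (c * u) (c * v) = hom_point u v.
Proof.
move=> c0; rewrite /hom_point mulf_eq0 (negPf c0) /=.
by case: eqP => // _; rewrite -mulf_div divff // mul1r.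
Qed.

Lemma hom_coordK (w : 'cV[k]_2) : w != 0 ->
  exists2 c, c != 0 &
    hom_coord (hom_point (w ord0 ord0) (w ord_max ord0)) = c *: w.
Proof.
move=> w0; rewrite /hom_point; case: (eqVneq (w ord_max ord0) 0) => w1.
  have u0 : w ord0 ord0 != 0.
    apply: contra_neq w0 => u0; apply/matrixP => i j.
    rewrite mxE (ord1 j : j = ord0).
    by case: (unliftP ord0 i) => [i' ->|-> //]; rewrite ord1 -[RHS]w1;
      congr (w _ _); apply: val_inj.
  exists (w ord0 ord0)^-1; first by rewrite invr_eq0.
  apply/matrixP => i j; rewrite !mxE (ord1 j : j = ord0).
  case: (unliftP ord0 i) => [i' ->|->] /=; last by rewrite mulVf.
  rewrite (ord1 i' : i' = ord0) (_ : lift _ _ = ord_max); last exact: val_inj.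
  by rewrite w1 mulr0.
exists (w ord_max ord0)^-1; first by rewrite invr_eq0.
apply/matrixP => i j; rewrite !mxE (ord1 j : j = ord0).
case: (unliftP ord0 i) => [i' ->|->] /=; last by rewrite mulrC.
rewrite (ord1 i' : i' = ord0) (_ : lift _ _ = ord_max); last exact: val_inj.
by rewrite mulVf.
Qed.

Lemma moebius1 (x : proj_line k) : moebius 1%:M x = x.
Proof. by rewrite /moebius mul1mx hom_pointK. Qed.

Lemma moebiusM (A B : 'M[k]_2) (x : proj_line k) : B \in unitmx ->
  moebius (A *m B) x = moebius A (moebius B x).
Proof.
move=> uB; have w0 : B *m hom_coord x != 0.
  apply: contra_neq (hom_coord_neq0 x) => Bx0.
  by rewrite -(mulKmx uB (hom_coord x)) Bx0 mulmx0.
have [c c0 cE] := hom_coordK w0.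
rewrite /moebius /= cE -mulmxA -scalemxAr.
by rewrite [in RHS]mxE [in X in _ = hom_point _ X]mxE hom_pointZ.
Qed.

End MoebiusAction.

(** * Covers of the projective line by the projective line *)

(* The pair [f = (P, Q)] stands for the morphism [P / Q]. *)
Definition ratmap (k : fieldType) : Type := ({poly k} * {poly k})%type.

Definition rdeg (k : fieldType) (f : ratmap k) : nat :=
  (maxn (size f.1) (size f.2)).-1.

(* Homogeneous coordinates of [f x]. At infinity, [P] and [Q] are evaluated as
   binary forms of degree [rdeg f]. *)
Definition hom_value (k : fieldType) (f : ratmap k) (x : proj_line k) : k * k :=
  if x is Some a then (f.1.[a], f.2.[a]) else (f.1`_(rdeg f), f.2`_(rdeg f)).

Definition value (k : fieldType) (f : ratmap k) (x : proj_line k) :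
    proj_line k :=
  hom_point (hom_value f x).1 (hom_value f x).2.

(* As a binary form of degree [rdeg f], this is the equation of the scheme
   theoretic fiber of [f] through [x]. *)
Definition fiber_form (k : fieldType) (f : ratmap k) (x : proj_line k) :
    {poly k} :=
  (hom_value f x).2 *: f.1 - (hom_value f x).1 *: f.2.

Definition ram_index (k : fieldType) (f : ratmap k) (x : proj_line k) : nat :=
  if x is Some a then mup a (fiber_form f x)
  else (rdeg f - (size (fiber_form f x)).-1)%N.

(* For coprime [P] and [Q], not both constant, [P(T) - t Q(T)] is, up to a
   scalar, the minimal polynomial over [k(t)] of the generator [x] of the
   function field extension [k(x) / k(t)], [t = P(x) / Q(x)]. *)
Definition generic_fiber (k : fieldType) (f : ratmap k) :
    {poly {fraction {poly k}}} :=
  let emb := map_poly (fun a : k => tofrac a%:P) in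
  emb f.1 - tofrac 'X *: emb f.2.

Definition is_cover (k : fieldType) (f : ratmap k) : Prop :=
  [/\ coprimep f.1 f.2, (0 < rdeg f)%N, separable_poly (generic_fiber f) &
      forall x, (ram_index f x)%:R != 0 :> k].

Definition branch_points (k : fieldType) (lam : k) : 4.-tuple (proj_line k) :=
  [tuple Some 0; Some 1; None; Some lam].

Definition has_ramification_type (k : fieldType) (d : nat)
    (e : 4.-tuple nat) (lam : k) (f : ratmap k) : Prop :=
  [/\ is_cover f,
      rdeg f = d,
      forall y, (exists2 x, value f x = y & (1 < ram_index f x)%N) <->
                (exists i, y = tnth (branch_points lam) i) &
      forall i, exists x,
        [/\ value f x = tnth (branch_points lam) i,
            ram_index f x = tnth e i &
            forall x', value f x' = tnth (branch_points lam) i ->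
              (1 < ram_index f x')%N -> x' = x]].

(* As [k] is infinite, a morphism is determined by its values on [k]-points. *)
Definition isomorphic_covers (k : closedFieldType) (f1 f2 : ratmap k) : Prop :=
  exists2 A : 'M[k]_2, A \in unitmx &
    forall x, value f2 (moebius A x) = value f1 x.

(** * The Hurwitz curve *)

(* A point of the parameter space lists the coefficients of [P] and [Q], of
   degree at most [d], followed by the fourth branch point. *)
Notation param_space k d := (affine_space k (d.+1 + d.+1 + 1)).

Definition param_map (k : closedFieldType) (d : nat) (v : param_space k d) :
    ratmap k :=
  (rVpoly (lsubmx (lsubmx (v : 'rV[k]_(d.+1 + d.+1 + 1)))),
   rVpoly (rsubmx (lsubmx (v : 'rV[k]_(d.+1 + d.+1 + 1))))).

Definition param_lambda (k : closedFieldType) (d : nat)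
    (v : param_space k d) : k :=
  rsubmx (v : 'rV[k]_(d.+1 + d.+1 + 1)) ord0 ord0.

Definition hurwitz_params (k : closedFieldType) (d : nat) (e : 4.-tuple nat) :
    set (param_space k d) :=
  [set v | [/\ param_lambda v != 0, param_lambda v != 1 &
    has_ramification_type d e (param_lambda v) (param_map v)]].

Section HurwitzCurve.
Variables (k : closedFieldType) (d : nat) (e : 4.-tuple nat).

Definition hurwitz_iso (v w : set_type (@hurwitz_params k d e)) : bool :=
  `[< isomorphic_covers (param_map (set_val v)) (param_map (set_val w)) >].

Lemma hurwitz_iso_refl : reflexive hurwitz_iso.
Proof.
move=> v; apply/asboolP; exists 1%:M => [|x]; first exact: unitmx1.
by rewrite moebius1.
Qed.

Lemma hurwitz_iso_impl v w : hurwitz_iso v w -> hurwitz_iso w v.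
Proof.
move=> /asboolP[A uA vw]; apply/asboolP; exists (invmx A) => [|x].
  by rewrite unitmx_inv.
by rewrite -vw -moebiusM ?unitmx_inv // mulmxV // moebius1.
Qed.

Lemma hurwitz_iso_sym : symmetric hurwitz_iso.
Proof. by move=> v w; apply/idP/idP; exact: hurwitz_iso_impl. Qed.

Lemma hurwitz_iso_trans : transitive hurwitz_iso.
Proof.
move=> v u w /asboolP[A uA uv] /asboolP[B uB vw]; apply/asboolP.
exists (B *m A) => [|x]; first by rewrite unitmx_mul uB.
by rewrite moebiusM // vw uv.
Qed.

Definition hurwitz_equiv : equiv_rel (set_type (@hurwitz_params k d e)) :=
  EquivRel hurwitz_iso hurwitz_iso_refl hurwitz_iso_sym hurwitz_iso_trans.

(* The [k]-points of the Hurwitz curve in genus [0], where the source of every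
   cover is isomorphic to [P^1]. The curve is the geometric quotient of the
   variety [hurwitz_params], a locally closed subvariety of affine space, by
   scalars and automorphisms of the source, so that its Zariski topology is the
   quotient topology. *)
Definition hurwitz_curve : topologicalType :=
  quotient_topology {eq_quot hurwitz_equiv}%qT.

End HurwitzCurve.

(* Main.v *)
Require Import Defs.
From mathcomp Require Import all_boot all_order all_algebra.
From mathcomp Require Import all_classical all_reals all_analysis.
From mathcomp Require Import generic_quotient separable ring zify.
Set Implicit Arguments.
Unset Strict Implicit.
Unset Printing Implicit Defensive.
Import GRing.Theory.
Local Open Scope classical_set_scope.
Local Open Scope ring_scope.

(** Composing with an automorphism of the source, one may assume that the
    ramified points over 0, 1 and infinity are 0, 1 and infinity themselves
    ([normalize_cover]). Let [mu] be the fourth ramified point and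
    [lam = f mu]. Then [f = P / Q] with [deg P = d], [deg Q = d - e3],
    [X^e1 | P], [(X - 1)^e2 | P - Q] and [(X - mu)^(p-1) | P - lam Q].

    The index [p - 1] is congruent to [-1] modulo [p], and the exponent
    difference [-1] is that of an unramified point. Indeed put
    [z1 = (X - mu) P] and [z2 = (X - mu) Q]. The Wronskian of [z1] and [z2] is
    a constant times [X^(e1-1) (X - 1)^(e2-1) (X - mu)^p], whose last factor
    is a constant for derivations. Hence [z1] and [z2] solve a second order
    differential equation with singularities 0, 1 and infinity only, namely
    the hypergeometric equation with exponents [0, e1] at 0, [0, e2] at 1 and
    degrees [d + 1] and [d + 1 - e3] at infinity. It does not depend on [mu]
    ([normalized_hypergeom]).

    On coefficients the equation is a two-term recurrence, with breaks at the
    indices congruent to 0 and [e1] modulo [p]. So its polynomial solutions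
    are the combinations, with coefficients in [k[X^p]], of two fixed
    solutions: [u], of degree [d + 1 - p < e1] with nonzero constant term, and
    [w], of order [e1] at 0 and of degree [d + 1 - e3 < p]. Degrees and orders
    at 0 leave only [z1 = be w + al X^p u] and [z2 = ga u + de w] with constant
    coefficients ([normalized_z_decomposition]), and the vanishing of [z1] and
    [z2] at [mu] determines the ratios. Up to scalars, [P] and [Q] are the
    Bezoutians of [X^p u, w] and of [u, w] at [mu], where the Bezoutian of
    [a, b] is [(a(mu) b - b(mu) a) / (X - mu)]; the scalars are fixed by
    [f 1 = 1] ([normalized_cover_in_family]).

    So every cover is isomorphic to a member of one family whose coefficients
    and branch point [lam] are rational functions of [mu]. Conversely the
    member at [mu] is a cover of the given type as soon as a certain nonzero
    polynomial does not vanish at [mu] ([family_ramification_type]). The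
    Hurwitz curve is thus empty, or the continuous image of a nonempty open
    subset of the affine line; in both cases it is connected
    ([connected_rational_family]). *)

(** * Wronskians *)

(** The Wronskian [F G' - F' G] of two polynomials. *)
Definition wronskian (R : comNzRingType) (F G : {poly R}) : {poly R} :=
  F * G^`() - F^`() * G.

Section Wronskian.
Variable k : fieldType.
Implicit Types (F G H P Q : {poly k}) (r c : k).

Lemma wronskianC F G : wronskian F G = - wronskian G F.
Proof. by rewrite /wronskian; ring. Qed.

Lemma wronskian_addmul F G c : wronskian (F + c *: G) G = wronskian F G.
Proof. by rewrite /wronskian !poly.derivE -!mul_polyC; ring. Qed.

Lemma wronskianZl F G c : wronskian (c *: F) G = c *: wronskian F G.
Proof. by rewrite /wronskian derivZ -!mul_polyC; ring. Qed.

Lemma wronskianZr F G c : wronskian F (c *: G) = c *: wronskian F G.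
Proof. by rewrite /wronskian derivZ -!mul_polyC; ring. Qed.

Lemma wronskianMM H F G : wronskian (H * F) (H * G) = H ^+ 2 * wronskian F G.
Proof. by rewrite /wronskian !derivM; ring. Qed.

Lemma deriv_wronskian F G :
  (wronskian F G)^`() = F * G^`()^`() - F^`()^`() * G.
Proof. by rewrite /wronskian !(derivB, derivM); ring. Qed.

(** Two polynomials are solutions of the second order linear differential
    equation that their Wronskians define. *)
Lemma wronskian_eq F G Z : Z = F \/ Z = G ->
  Z^`()^`() * wronskian F G - Z^`() * (wronskian F G)^`()
    + Z * wronskian F^`() G^`() = 0.
Proof. by rewrite deriv_wronskian /wronskian => -[]->; ring. Qed.

Lemma dvdp_deriv_XsubC m r F :
  ('X - r%:P) ^+ m.+1 %| F -> ('X - r%:P) ^+ m %| F^`().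
Proof.
move=> /dvdpP[G ->]; rewrite derivM deriv_exp /= derivXsubC mul1r exprS.
by rewrite mulrnAr dvdp_add ?dvdp_mull ?dvdpp // -mulrnAl dvdp_mull.
Qed.

Lemma dvdp_wronskian m r F G :
  ('X - r%:P) ^+ m.+1 %| F -> ('X - r%:P) ^+ m %| wronskian F G.
Proof.
move=> h; rewrite dvdp_sub ?dvdp_mulr ?dvdp_deriv_XsubC //.
by apply: dvdp_trans h; rewrite exprS dvdp_mull.
Qed.

Lemma size_mul_le m n F G : (size F <= m.+1)%N -> (size G <= n.+1)%N ->
  (size (F * G)%R <= (m + n).+1)%N.
Proof.
move=> sF sG; apply: leq_trans (size_polyMleq _ _) _.
by have := leq_add sF sG; rewrite addSn addnS; case: (_ + _)%N.
Qed.

Lemma coef_mul_top m n F G : (size F <= m.+1)%N -> (size G <= n.+1)%N ->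
  (F * G)`_(m + n) = F`_m * G`_n.
Proof.
move=> sF sG; rewrite coefM.
have hm : (m < (m + n).+1)%N by rewrite ltnS leq_addr.
rewrite (bigD1 (Ordinal hm)) //= addKn big1 ?addr0 // => i ne.
have ne' : (i : nat) != m by [].
have [lt|gt] : (i < m)%N \/ (m < i)%N by move: ne'; rewrite neq_ltn => /orP.
  rewrite [G`__]nth_default ?mulr0 //; apply: leq_trans sG _.
  lia.
by rewrite [F`__]nth_default ?mul0r //; apply: leq_trans sF _.
Qed.

Lemma coef_top_neq0 m F : size F = m.+1 -> F`_m != 0.
Proof.
by move=> s; have := lead_coef_eq0 F; rewrite lead_coefE s /= => ->; rewrite -size_poly_eq0 s.
Qed.

Lemma coef_Xderiv F i : ('X * F^`())`_i = i%:R * F`_i.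
Proof. by rewrite coefXM; case: i => [|i] /=; rewrite ?mul0r // coef_deriv mulr_natl. Qed.

Lemma size_Xderiv F : (size ('X * F^`())%R <= size F)%N.
Proof.
apply/leq_sizeP => i h; rewrite coef_Xderiv nth_default ?mulr0 //.
Qed.

Lemma Xwronskian F G : 'X * wronskian F G = F * ('X * G^`()) - 'X * F^`() * G.
Proof. by rewrite /wronskian; ring. Qed.

Lemma size_wronskian_le m n F G : (size F <= m.+1)%N -> (size G <= n.+1)%N ->
  (size (wronskian F G) <= m + n)%N.
Proof.
move=> sF sG; have [->|W0] := eqVneq (wronskian F G) 0; first by rewrite size_poly0.
rewrite -ltnS -size_mulX // mulrC Xwronskian.
rewrite (leq_trans (size_polyD _ _)) // size_polyN geq_max.
by rewrite !size_mul_le // (leq_trans (size_Xderiv _)).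
Qed.

(** The leading coefficients cancel in the Wronskian precisely when the two
    degrees agree in [k]. *)
Lemma size_wronskian m n F G : size F = m.+1 -> size G = n.+1 ->
  m%:R != n%:R :> k -> size (wronskian F G) = (m + n)%N.
Proof.
move=> sF sG ne; have le : (size (wronskian F G) <= m + n)%N.
  by rewrite size_wronskian_le ?sF ?sG.
have c : ('X * wronskian F G)`_(m + n) = (n%:R - m%:R) * F`_m * G`_n.
  rewrite Xwronskian coefB !coef_mul_top ?sF ?sG //;
    try by rewrite -?sF -?sG size_Xderiv.
  by rewrite !coef_Xderiv; ring.
have c0 : ('X * wronskian F G)`_(m + n) != 0.
  by rewrite c !mulf_neq0 ?coef_top_neq0 // subr_eq0 eq_sym.
have W0 : wronskian F G != 0 by apply: contraNneq c0 => ->; rewrite mulr0 coef0.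
apply/eqP; rewrite eqn_leq le -ltnS -size_mulX // mulrC.
by rewrite ltnNge; apply: contra_neqN c0 => h; rewrite nth_default.
Qed.

(** A multiple of [F] of degree at most that of [F] is a scalar multiple. *)
Lemma dvdp_size_scale F G : F != 0 -> F %| G -> (size G <= size F)%N ->
  exists c, G = c *: F.
Proof.
move=> F0 /dvdpP[H ->] s; have [->|H0] := eqVneq H 0.
  by exists 0; rewrite mul0r scale0r.
move: s; rewrite size_mul // => s.
have s1 : (size H <= 1)%N by move: s; case: (size H) => [|[|n]] //; rewrite !addSn /= ltnNge leq_addl.
by exists (H`_0); rewrite [in LHS](size1_polyC s1) mul_polyC.
Qed.

Lemma dvdp_prod3 (r s t : k) (a b c : nat) F : r != s -> r != t -> s != t ->
  ('X - r%:P) ^+ a %| F -> ('X - s%:P) ^+ b %| F -> ('X - t%:P) ^+ c %| F ->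
  ('X - r%:P) ^+ a * ('X - s%:P) ^+ b * ('X - t%:P) ^+ c %| F.
Proof.
have cp x y m n : x != y -> coprimep (('X - x%:P) ^+ m) (('X - y%:P) ^+ n).
  by move=> ne; rewrite coprimep_expl // coprimep_expr // coprimep_XsubC root_XsubC eq_sym.
move=> rs rt st hr hs ht; rewrite Gauss_dvdp ?ht ?andbT; last first.
  by rewrite coprimepMl !cp.
by rewrite Gauss_dvdp ?hr ?hs // cp.
Qed.

Lemma size_prod3 (r s t : k) (a b c : nat) :
  size (('X - r%:P) ^+ a * ('X - s%:P) ^+ b * ('X - t%:P) ^+ c)%R = (a + b + c).+1.
Proof.
by rewrite !size_Mmonic ?monic_neq0 ?rpredM ?rpredX ?monicXsubC //
   !size_exp_XsubC !addnS.
Qed.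

Lemma prod3_neq0 (r s t : k) (a b c : nat) :
  ('X - r%:P) ^+ a * ('X - s%:P) ^+ b * ('X - t%:P) ^+ c != 0.
Proof. by rewrite -size_poly_eq0 size_prod3. Qed.

End Wronskian.

(** * Bezoutians *)

Section Bezoutian.
Variable k : fieldType.
Implicit Types (a b : {poly k}) (mu : k).

(** The Bezoutian of [a] and [b] with one variable specialized to [mu]. *)
Definition bezoutian a b mu : {poly k} :=
  (a.[mu] *: b - b.[mu] *: a) %/ ('X - mu%:P).

Lemma bezoutianE a b mu :
  ('X - mu%:P) * bezoutian a b mu = a.[mu] *: b - b.[mu] *: a.
Proof.
rewrite mulrC divpK // dvdp_XsubCl rootE !hornerE.
by rewrite mulrC subrr.
Qed.

Lemma horner_bezoutian a b mu : (bezoutian a b mu).[mu] = (wronskian a b).[mu].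
Proof.
have := congr1 (fun f => f^`().[mu]) (bezoutianE a b mu).
by rewrite /wronskian !poly.derivE !hornerE subrr mul0r addr0 [b.[mu] * _]mulrC.
Qed.

(** The coefficients of the Bezoutian are polynomial functions of [mu], given
    by the coefficients of a polynomial in two variables. *)
Lemma bezoutian_family a b : exists B : {poly {poly k}}, forall mu,
  bezoutian a b mu = map_poly (horner_eval mu) B.
Proof.
pose N : {poly {poly k}} := a *: map_poly polyC b - b *: map_poly polyC a.
have ev mu c : map_poly (horner_eval mu) (map_poly polyC c) = c.
  by apply/polyP => i; rewrite !coef_map /= /horner_eval hornerC.
have [B NE] : exists B, N = B * ('X - 'X%:P).
  apply/factor_theorem; rewrite rootE /N hornerD hornerN !hornerZ.
  rewrite -!/(_ \Po _) !comp_polyXr.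
  by rewrite mulrC subrr.
exists B => mu; have mu0 : 'X - mu%:P != 0 by rewrite polyXsubC_eq0.
apply: (mulfI mu0); rewrite bezoutianE.
have := congr1 (map_poly (horner_eval mu)) NE.
rewrite /N rmorphB rmorphM rmorphB /= map_polyX map_polyC /= !map_polyZ /= !ev.
by rewrite /horner_eval hornerX [RHS]mulrC.
Qed.

End Bezoutian.

(** * Normalized covers and the hypergeometric equation *)

(** What is used of a cover [P / Q] of type [(d; e1, e2, e3, p - 1)] whose
    ramified points over 0, 1, infinity and [lam] are 0, 1, infinity and [mu].
    The last two fields hold since [P / Q] takes finite values at 0 and 1. *)
Record normalized_cover (k : fieldType) (p d e1 e2 e3 : nat) (mu lam : k)
    (P Q : {poly k}) : Prop := NormalizedCover {
  nc_mu0 : mu != 0;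
  nc_mu1 : mu != 1;
  nc_lam1 : lam != 1;
  nc_sizeP : size P = d.+1;
  nc_sizeQ : (size Q + e3 = d.+1)%N;
  nc_zero : 'X ^+ e1 %| P;
  nc_one : ('X - 1%:P) ^+ e2 %| P - Q;
  nc_mu : ('X - mu%:P) ^+ p.-1 %| P - lam *: Q;
  nc_Q0 : Q.[0] != 0;
  nc_Q1 : Q.[1] != 0 }.

Section Hypergeometric.
Variables (k : fieldType) (p : nat).
Hypotheses (p_prime : prime p) (char_k : p \in [pchar k]).

Lemma natr_eq_pchar (m n : nat) :
  (m%:R == n%:R :> k) -> (m <= n)%N -> (p %| n - m)%N.
Proof. by move=> /eqP mn le; rewrite (dvdn_pcharf char_k) natrB // mn subrr. Qed.

Lemma natr_neq0 n : (0 < n < p)%N -> n%:R != 0 :> k.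
Proof.
by move=> /andP[n0 np]; rewrite -(dvdn_pcharf char_k) gtnNdvd.
Qed.

Lemma natr_neq m n : (m < n)%N -> (n < m + p)%N -> m%:R != n%:R :> k.
Proof.
move=> lt lt'; apply/negP => /natr_eq_pchar /(_ (ltnW lt)) h.
by have := dvdn_leq _ h; rewrite subn_gt0 => /(_ lt); lia.
Qed.

Lemma deriv_XsubCp (r : k) : (('X - r%:P) ^+ p)^`() = 0.
Proof.
by rewrite deriv_exp -mulr_natr -polyC_natr (pcharf0 char_k) polyC0 mulr0.
Qed.

Lemma dvdp_deriv_XsubCp (r : k) F :
  ('X - r%:P) ^+ p %| F -> ('X - r%:P) ^+ p %| F^`().
Proof.
by move=> /dvdpP[G ->]; rewrite derivM deriv_XsubCp mulr0 addr0 dvdp_mull.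
Qed.

(** Unlike [dvdp_wronskian], no factor is lost: a [p]-th power is a constant
    for derivations. *)
Lemma dvdp_wronskian_p (r : k) F G :
  ('X - r%:P) ^+ p %| F -> ('X - r%:P) ^+ p %| wronskian F G.
Proof. by move=> h; rewrite dvdp_sub ?dvdp_mulr ?dvdp_deriv_XsubCp. Qed.

Variables (e1 e2 e3 d : nat).
Hypotheses (he1 : (1 < e1 < p)%N) (he2 : (1 < e2 < p)%N) (he3 : (1 < e3 < p)%N).
Hypothesis hd : (d.*2 + 3 = e1 + e2 + e3 + p)%N.

(* the degrees of [z1] and [z2] below; [e3 <= d] whenever a cover exists *)
Let A : nat := d.+1.
Let B : nat := (d.+1 - e3)%N.

(** The hypergeometric equation
    [X (X - 1) z'' - ((e1 - 1) (X - 1) + (e2 - 1) X) z' + A B z = 0], written on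
    the coefficients of [z]. Here [A + B = e1 + e2 - 1] in [k], so that [e2] is
    determined by the other parameters. *)
Definition hypergeom (z : {poly k}) := forall n : nat,
  (n%:R - A%:R) * (n%:R - B%:R) * z`_n = n.+1%:R * (n.+1%:R - e1%:R) * z`_n.+1.

(** The ramification divisor on the affine line, with multiplicity [n] at
    [mu]. *)
Definition ramification_poly (mu : k) (n : nat) : {poly k} :=
  ('X - 0%:P) ^+ e1.-1 * ('X - 1%:P) ^+ e2.-1 * ('X - mu%:P) ^+ n.

Lemma dvdp_ramification_poly mu n F : mu != 0 -> mu != 1 ->
  ('X - 0%:P) ^+ e1.-1 %| F -> ('X - 1%:P) ^+ e2.-1 %| F ->
  ('X - mu%:P) ^+ n %| F -> ramification_poly mu n %| F.
Proof.
by move=> mu0 mu1; apply: dvdp_prod3; rewrite eq_sym ?oner_eq0.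
Qed.

(** The family of candidate covers: up to scalars, numerator and denominator
    of the cover whose fourth ramified point is [mu]. *)
Definition family_num (u w : {poly k}) (mu : k) : {poly k} := bezoutian ('X^p * u) w mu.

Definition family_den (u w : {poly k}) (mu : k) : {poly k} := bezoutian u w mu.

(** The open condition on [mu] for [family_num] and [family_den] to define a
    cover of the right type. *)
Definition admissible (u w : {poly k}) (mu : k) : bool :=
  [&& mu != 0, mu != 1, u.[mu] != 0, w.[mu] != 0, u.[1] != 0,
      (family_num u w mu).[1] != 0 & (family_den u w mu).[1] != 0].

Lemma deriv_Xp_mul (F : {poly k}) : ('X^p * F)^`() = 'X^p * F^`().
Proof.
have := deriv_XsubCp 0; rewrite subr0 => e.
by rewrite derivM e mul0r add0r.
Qed.

Lemma wronskian_Xp_mul (F G : {poly k}) : wronskian ('X^p * F) G = 'X^p * wronskian F G.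
Proof. by rewrite /wronskian deriv_Xp_mul; ring. Qed.

Lemma family_num_mu u w mu :
  (family_num u w mu).[mu] = mu ^+ p * (wronskian u w).[mu].
Proof. by rewrite horner_bezoutian wronskian_Xp_mul hornerM hornerXn. Qed.

Lemma family_den_mu u w mu : (family_den u w mu).[mu] = (wronskian u w).[mu].
Proof. exact: horner_bezoutian. Qed.

Lemma family_numE u w mu : ('X - mu%:P) * family_num u w mu =
  (mu ^+ p * u.[mu]) *: w - w.[mu] *: ('X^p * u).
Proof. by rewrite bezoutianE hornerM hornerXn. Qed.

Lemma family_denE u w mu : ('X - mu%:P) * family_den u w mu =
  u.[mu] *: w - w.[mu] *: u.
Proof. exact: bezoutianE. Qed.

Section Normalized.
Variables (mu lam : k) (P Q : {poly k}).
Hypothesis nc : normalized_cover p d e1 e2 e3 mu lam P Q.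

Let z1 := ('X - mu%:P) * P.
Let z2 := ('X - mu%:P) * Q.

Lemma normalized_Q_neq0 : Q != 0.
Proof. by apply: contraNneq (nc_Q0 nc) => ->; rewrite horner0. Qed.

Lemma normalized_P_neq0 : P != 0.
Proof. by rewrite -size_poly_eq0 (nc_sizeP nc). Qed.

Lemma normalized_e3_le : (e3 <= d)%N.
Proof.
have := nc_sizeQ nc; have : (0 < size Q)%N by rewrite size_poly_gt0 normalized_Q_neq0.
lia.
Qed.

Lemma size_normalized_z1 : size z1 = A.+1.
Proof.
rewrite /z1 mulrC size_Mmonic ?monicXsubC ?normalized_P_neq0 //.
by rewrite size_XsubC addn2 (nc_sizeP nc).
Qed.

Lemma size_normalized_z2 : size z2 = B.+1.
Proof.
rewrite /z2 mulrC size_Mmonic ?monicXsubC ?normalized_Q_neq0 //.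
by rewrite size_XsubC addn2 /B -(nc_sizeQ nc) addnK.
Qed.

(** A fiber contains a point of multiplicity [p - 1], so that
    [p - 1 <= d]. *)
Lemma normalized_p_le : (p <= A)%N.
Proof.
have sF : size (P - lam *: Q) = d.+1.
  rewrite size_polyDl (nc_sizeP nc) // size_polyN.
  rewrite (leq_ltn_trans (size_scale_leq _ _)) //.
  by rewrite ?(nc_sizeP nc) -(nc_sizeQ nc) -addn1 leq_add2l; lia.
have F0 : P - lam *: Q != 0 by rewrite -size_poly_eq0 sF.
have := dvdp_leq F0 (nc_mu nc); rewrite sF size_exp_XsubC prednK ?prime_gt0 //.
Qed.

Lemma normalized_dvdp_0 : 'X ^+ e1 %| z1.
Proof. by rewrite dvdp_mull // (nc_zero nc). Qed.

Lemma normalized_dvdp_1 : ('X - 1%:P) ^+ e2 %| z1 - z2.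
Proof. by rewrite -mulrBr dvdp_mull // (nc_one nc). Qed.

Lemma normalized_dvdp_mu : ('X - mu%:P) ^+ p %| z1 - lam *: z2.
Proof.
rewrite scalerAr -mulrBr -(prednK (prime_gt0 p_prime)) exprS.
by rewrite dvdp_mul // (nc_mu nc).
Qed.

(** The right-hand side divides the Wronskian, and both have the same
    degree. *)
Lemma normalized_wronskian : exists2 c, c != 0 &
  wronskian z1 z2 = c *: ramification_poly mu p.
Proof.
have le3 := normalized_e3_le; have leA := normalized_p_le.
have sW : size (wronskian z1 z2) = (A + B)%N.
  apply: size_wronskian size_normalized_z1 size_normalized_z2 _; rewrite eq_sym natr_neq // /A /B.
    by lia.
  by lia.
have sR : size (ramification_poly mu p) = (A + B)%N.
  by rewrite size_prod3 /A /B; lia.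
have [|||c cE] := @dvdp_size_scale _ (ramification_poly mu p) (wronskian z1 z2).
- exact: prod3_neq0.
- apply: (dvdp_ramification_poly (nc_mu0 nc) (nc_mu1 nc)).
  + by apply: dvdp_wronskian; rewrite subr0 prednK ?normalized_dvdp_0 //; lia.
  + rewrite -(wronskian_addmul _ _ (-1)) scaleN1r.
    by apply: dvdp_wronskian; rewrite prednK ?normalized_dvdp_1 //; lia.
  + rewrite -(wronskian_addmul _ _ (- lam)) scaleNr.
    by apply: dvdp_wronskian_p; rewrite normalized_dvdp_mu.
- by rewrite sW sR.
exists c => //; apply: contra_eq_neq cE => ->.
by rewrite scale0r -size_poly_eq0 sW /A addSn.
Qed.

(** The zeroth order coefficient of the differential equation satisfied by
    [z1] and [z2] has at most simple poles at 0 and 1, and no other pole. *)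
Lemma normalized_accessory : exists kap,
  'X * ('X - 1%:P) * wronskian z1^`() z2^`() = kap *: ramification_poly mu p.
Proof.
have le3 := normalized_e3_le; have leA := normalized_p_le.
have sR : size (ramification_poly mu p) = (A + B)%N.
  by rewrite size_prod3 /A /B; lia.
have sd (z : {poly k}) n : size z = n.+1 -> (size z^`() <= n)%N.
  move=> s; rewrite -ltnS -s lt_size_deriv // -size_poly_eq0 s //.
have bnd (f : {poly k}) (r : k) m : (1 < m)%N ->
    ('X - r%:P) ^+ m %| f -> ('X - r%:P) ^+ m.-1 %| ('X - r%:P) * wronskian f^`() z2^`().
  case: m => [|[|m]] //= _ h; rewrite exprS dvdp_mul //.
  by apply: dvdp_wronskian; apply: dvdp_deriv_XsubC.
have add c : wronskian z1^`() z2^`() = wronskian (z1 + c *: z2)^`() z2^`().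
  by rewrite derivD derivZ wronskian_addmul.
apply: dvdp_size_scale.
- exact: prod3_neq0.
- apply: (dvdp_ramification_poly (nc_mu0 nc) (nc_mu1 nc)).
  + rewrite mulrAC dvdp_mulr // -{2}['X](subr0) -polyC0 bnd ?subr0 ?normalized_dvdp_0 //.
    by lia.
  + rewrite -mulrA dvdp_mull // (add (-1)) scaleN1r bnd ?normalized_dvdp_1 //.
    by lia.
  + rewrite dvdp_mull // (add (- lam)) scaleNr dvdp_wronskian_p //.
    by rewrite dvdp_deriv_XsubCp // normalized_dvdp_mu.
- rewrite sR.
  have sV : (size (wronskian z1^`() z2^`()) <= d + B.-1)%N.
    rewrite size_wronskian_le //; first exact: sd size_normalized_z1.
    by rewrite prednK ?(sd _ _ size_normalized_z2) // /B; lia.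
  have sXX : size ('X * ('X - 1%:P) : {poly k}) = 3.
    by rewrite mulrC size_mulX ?polyXsubC_eq0 // size_XsubC.
  rewrite (leq_trans (size_polyMleq _ _)) // sXX /= /A.
  rewrite -(leq_add2l 2) in sV; apply: leq_trans sV _.
  by rewrite /B; lia.
Qed.

Lemma deriv_ramification_poly :
  'X * ('X - 1%:P) * (ramification_poly mu p)^`() =
    (e1.-1%:R * ('X - 1%:P) + e2.-1%:R * 'X) * ramification_poly mu p.
Proof.
rewrite /ramification_poly subr0 !derivM deriv_XsubCp mulr0 addr0.
rewrite !deriv_exp derivX derivXsubC !mul1r.
have [n1 ->] : exists n, e1 = n.+2 by exists e1.-2; lia.
have [n2 ->] : exists n, e2 = n.+2 by exists e2.-2; lia.
rewrite !succnK ![_ ^+ _.+1]exprS -(mulr_natl 'X^n1) -(mulr_natl (_ ^+ n2)).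
by ring.
Qed.

(** The equation of [wronskian_eq] for [z1] and [z2] is, after division by
    their Wronskian, the hypergeometric equation; the accessory constant is
    read off the leading coefficient of [z1]. *)
Lemma normalized_hypergeom z : z = z1 \/ z = z2 -> hypergeom z.
Proof.
have le3 := normalized_e3_le; have leA := normalized_p_le.
have [c c0 W] := normalized_wronskian; have [kap0 V] := normalized_accessory.
pose kap := kap0 / c.
have {V} V : 'X * ('X - 1%:P) * wronskian z1^`() z2^`() =
    kap *: wronskian z1 z2.
  by rewrite V W scalerA /kap mulfVK.
have W0 : wronskian z1 z2 != 0.
  by rewrite W scaler_eq0 negb_or c0 prod3_neq0.
have ode z' : z' = z1 \/ z' = z2 -> 'X * ('X - 1%:P) * z'^`()^`()
    - (e1.-1%:R * ('X - 1%:P) + e2.-1%:R * 'X) * z'^`() + kap *: z' = 0.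
  move=> zE; apply: (mulfI W0); rewrite mulr0.
  have dW : 'X * ('X - 1%:P) * (wronskian z1 z2)^`() =
      (e1.-1%:R * ('X - 1%:P) + e2.-1%:R * 'X) * wronskian z1 z2.
    by rewrite W derivZ -!scalerAr deriv_ramification_poly.
  have := congr1 (fun f => 'X * ('X - 1%:P) * f) (wronskian_eq zE).
  rewrite mulr0 mulrDr mulrBr => e.
  rewrite -[RHS]e; rewrite -mul_polyC in V.
  set T := wronskian z1 z2 in dW V e *; set D := 'X * ('X - 1%:P) in dW V e *.
  have -> : D * (z'^`() * T^`()) = z'^`() * (D * T^`()) by ring.
  have -> : D * (z' * wronskian z1^`() z2^`()) = z' * (D * wronskian z1^`() z2^`()) by ring.
  by rewrite -[kap *: z']mul_polyC dW V; ring.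
have rec z' : z' = z1 \/ z' = z2 -> forall n : nat,
    (n%:R * (n%:R - 1) - (e1.-1%:R + e2.-1%:R) * n%:R + kap) * z'`_n =
    n.+1%:R * (n.+1%:R - e1%:R) * z'`_n.+1.
  move=> /ode e n; have := congr1 (fun f : {poly k} => f`_n) e.
  have -> : 'X * ('X - 1%:P) * z'^`()^`()
    - (e1.-1%:R * ('X - 1%:P) + e2.-1%:R * 'X) * z'^`() + kap *: z' =
    'X * ('X * z'^`())^`() - 'X * z'^`() - 'X * z'^`()^`()
    + e1.-1%:R%:P * z'^`() - (e1.-1%:R + e2.-1%:R)%:P * ('X * z'^`()) + kap *: z'.
    by rewrite derivM derivX !polyCD !polyC_natr polyC1; ring.
  rewrite coef0 !(coefD, coefB, coefN, coefCM, coefZ, coef_Xderiv, coef_deriv).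
  move=> e'; apply/eqP; rewrite -subr_eq0; apply/eqP.
  rewrite -[RHS]e'.
  have -> : e1%:R = e1.-1%:R + 1 :> k by rewrite natr1 prednK //; lia.
  rewrite -[n.+1%:R]natr1; ring.
have AB : A%:R + B%:R = e1.-1%:R + e2.-1%:R + 1 :> k.
  rewrite -natrD (_ : A + B = e1.-1 + e2.-1 + 1 + p)%N; last by rewrite /A /B; lia.
  by rewrite natrD (pcharf0 char_k) addr0 !natrD.
(* the coefficient of index [A] of the equation for [z1], of degree [A] *)
have kapE : kap = A%:R * B%:R.
  have := rec z1 (or_introl erefl) A; rewrite [z1`_A.+1]nth_default ?size_normalized_z1 //.
  rewrite mulr0 => /eqP; rewrite mulf_eq0 (negPf (coef_top_neq0 size_normalized_z1)) orbF.
  have -> : B%:R = e1.-1%:R + e2.-1%:R + 1 - A%:R :> k by rewrite -AB; ring.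
  move=> /eqP e; rewrite -[LHS]subr0 -e; ring.
move=> zE n; rewrite -rec // kapE; congr (_ * _).
have -> : e1.-1%:R + e2.-1%:R = A%:R + B%:R - 1 :> k by rewrite AB; ring.
by ring.
Qed.

(** The recurrence propagates a zero up to the next index congruent to 0 or
    [e1] modulo [p]. *)
Lemma hypergeom_eq0 (z : {poly k}) (s t : nat) : hypergeom z -> z`_s = 0 ->
  (t <= p)%N -> (forall n, s <= n -> n.+1 < t -> n.+1 != e1)%N ->
  forall i, (s <= i < t)%N -> z`_i = 0.
Proof.
move=> hz zs tp ne; elim=> [|i IHi] /andP[si it].
  by move: si; rewrite leqn0 => /eqP <-.
move: si; rewrite leq_eqVlt => /orP[/eqP <- //|]; rewrite ltnS => si.
have /esym/eqP := hz i; rewrite IHi ?si ?(ltnW it) // mulr0 !mulf_eq0.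
rewrite subr_eq0 (negPf (natr_neq0 _)) /=; last by lia.
have /negPf-> : i.+1%:R != e1%:R :> k.
  have := ne i si it; rewrite neq_ltn => /orP[lt|lt]; first by apply: natr_neq; lia.
  by rewrite eq_sym; apply: natr_neq; lia.
by move=> /eqP.
Qed.

Lemma hypergeomD (y z : {poly k}) (c : k) :
  hypergeom y -> hypergeom z -> hypergeom (y - c *: z).
Proof.
move=> hy hz n; rewrite !coefB !coefZ mulrBr [RHS]mulrBr hy; congr (_ - _).
by rewrite !(mulrCA _ c) hz.
Qed.

(** The recurrence has a break at the indices [e1] and [p]. *)
Lemma hypergeom_take (z : {poly k}) (t : nat) : t = e1 \/ t = p ->
  hypergeom z -> hypergeom (take_poly t z).
Proof.
move=> tE hz n; rewrite !coef_take_poly; case: (ltngtP n.+1 t) => [_|_|nt].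
- exact: hz.
- by rewrite !mulr0.
rewrite hz mulr0; move: nt; case: tE => -> ->.
  by rewrite subrr !(mulr0, mul0r).
by rewrite (pcharf0 char_k) !mul0r.
Qed.

Lemma hypergeom_drop (z : {poly k}) : hypergeom z -> hypergeom (drop_poly p z).
Proof.
move=> hz n; rewrite !coef_drop_poly addSn -[in RHS]addSn.
have addp m : m%:R = (m + p)%:R :> k by rewrite natrD (pcharf0 char_k) addr0.
by rewrite (addp n) (addp n.+1) hz addSn.
Qed.

(** The degree of a solution is, modulo [p], one of the two exponents at
    infinity. *)
Lemma hypergeom_degree (z : {poly k}) (n : nat) : hypergeom z -> size z = n.+1 ->
  n%:R = A%:R :> k \/ n%:R = B%:R :> k.
Proof.
move=> hz sz; have /eqP := hz n; rewrite [z`_n.+1]nth_default ?sz //.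
rewrite mulr0 !mulf_eq0 (negPf (coef_top_neq0 sz)) orbF !subr_eq0.
by move=> /orP[]/eqP; [left|right].
Qed.

(** A basis, over [k[X^p]], of the polynomial solutions of the hypergeometric
    equation, together with the inequalities between the parameters that its
    existence forces. *)
Record hypergeom_basis (u w : {poly k}) : Prop := HypergeomBasis {
  hb_u : hypergeom u;
  hb_w : hypergeom w;
  hb_leA : (p <= A)%N;
  hb_ltA : (A - p < e1)%N;
  hb_B : (e1 <= B < p)%N;
  hb_size_u : size u = (A - p).+1;
  hb_size_w : size w = B.+1;
  hb_u0 : u`_0 != 0;
  hb_w_low : forall i, (i < e1)%N -> w`_i = 0;
  hb_we1 : w`_e1 != 0 }.

Lemma normalized_coef_low i : (i < e1)%N -> z1`_i = 0.
Proof. by move=> lt; have /dvdpP[G ->] := normalized_dvdp_0; rewrite coefMXn lt. Qed.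

(** If this coefficient were zero, [X^p] would divide [z1], and the Wronskian
    would vanish to order at least [e1] at 0. *)
Lemma normalized_coef_e1 : z1`_e1 != 0.
Proof.
apply/eqP => z1e; have [c c0 W] := normalized_wronskian.
have low i : (i < p)%N -> z1`_i = 0.
  move=> ip; have [/normalized_coef_low //|le] := ltnP i e1.
  apply: (hypergeom_eq0 (normalized_hypergeom (or_introl erefl)) z1e (leqnn p)) => [n|].
    by lia.
  by rewrite le.
have : ('X - 0%:P) ^+ e1 %| wronskian z1 z2.
  apply: (@dvdp_trans _ (('X - 0%:P) ^+ p)).
    by rewrite dvdp_exp2l //; lia.
  apply: dvdp_wronskian_p; apply/dvdpP; exists (drop_poly p z1).
  rewrite subr0 -{1}(poly_take_drop p z1) (_ : take_poly _ _ = 0) ?add0r //.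
  by apply/polyP => i; rewrite coef_take_poly coef0; case: ifP => // /low.
rewrite W dvdpZr // /ramification_poly -mulrA.
rewrite -{1}(prednK (ltnW (proj1 (andP he1)))) exprSr dvdp_mul2l ?expf_neq0 ?polyXsubC_eq0 //.
rewrite dvdp_XsubCl rootE hornerM !horner_exp !hornerXsubC mulf_eq0 !expf_eq0.
by rewrite !sub0r !oppr_eq0 oner_eq0 (negPf (nc_mu0 nc)) !andbF.
Qed.

Lemma normalized_coef_0 : z2`_0 != 0.
Proof.
rewrite -horner_coef0 hornerM hornerXsubC sub0r mulf_neq0 ?oppr_eq0 ?(nc_mu0 nc) //.
exact: nc_Q0 nc.
Qed.

(** [u] and [w] are truncations of [z2] and [z1]; their degrees are known
    modulo [p] by [hypergeom_degree], and the bounds on the parameters leave a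
    single possibility. *)
Lemma hypergeom_basis_exists : exists u w, hypergeom_basis u w.
Proof.
have le3 := normalized_e3_le; have leA := normalized_p_le.
have h1 := normalized_hypergeom (or_introl erefl).
have h2 := normalized_hypergeom (or_intror erefl).
pose u := take_poly e1 z2; pose w := take_poly p z1.
have hu : hypergeom u by apply: hypergeom_take => //; left.
have hw : hypergeom w by apply: hypergeom_take => //; right.
have u0 : u`_0 != 0 by rewrite coef_take_poly ltnW ?normalized_coef_0 //; case/andP: he1.
have we1 : w`_e1 != 0 by rewrite coef_take_poly (proj2 (andP he1)) normalized_coef_e1.
have su : exists2 m, size u = m.+1 & (m < e1)%N.
  exists (size u).-1; last first.
    by apply: leq_ltn_trans (_ : e1.-1 < e1)%N; [rewrite -!subn1 leq_sub2r ?size_take_poly | lia].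
  by rewrite prednK // size_poly_gt0; apply: contraNneq u0 => ->; rewrite coef0.
have sw : exists2 n, size w = n.+1 & (e1 <= n < p)%N.
  have lt : (e1 < size w)%N by rewrite ltnNge; apply: contraNN we1 => /(nth_default 0) ->.
  exists (size w).-1; first by rewrite prednK // (leq_ltn_trans _ lt).
  have := size_take_poly p z1; rewrite -/w => le; move: lt le.
  by case: (size w) => // n; rewrite !ltnS => -> /=.
have [m sm lm] := su; have [n sn ln] := sw.
(* natural numbers below [p] and [2 p] that are equal in [k] *)
have step i j : i%:R = j%:R :> k -> (i < p)%N -> (j < p.*2)%N ->
    i = j \/ (i + p)%N = j.
  move=> ij ip jp; have [le|lt] := leqP i j.
    have /dvdnP[[|[|q]] h] := natr_eq_pchar (introT eqP ij) le.
    - by left; lia.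
    - by right; lia.
    - by nia.
  have /dvdnP[[|q] h] := natr_eq_pchar (introT eqP (esym ij)) (ltnW lt).
    by lia.
  by nia.
have mp : (m < p)%N by lia.
have np : (n < p)%N by lia.
have lA : (A < p.*2)%N by rewrite /A; lia.
have lB : (B < p.*2)%N by rewrite /B; lia.
have mE := hypergeom_degree hu sm; have nE := hypergeom_degree hw sn.
have [mE1 nE1] : m = (A - p)%N /\ n = B.
  have AE : A = d.+1 by []; have BE : B = (d.+1 - e3)%N by [].
  case: mE nE => /step/(_ mp) hm []/step/(_ np) hn;
    by case: (hm _) => [//||]; case: (hn _) => [//||]; lia.
exists u, w; split=> //; rewrite -?mE1 -?nE1 //.
by move=> i ie; rewrite coef_take_poly normalized_coef_low // if_same.
Qed.



Section Decomposition.
Variables (u w : {poly k}).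
Hypothesis hb : hypergeom_basis u w.

(** A solution is determined below [X^p] by its coefficients of index 0 and
    [e1]. Subtracting multiples of [u] and [w] thus leaves a multiple of [X^p],
    which is zero for [z2], of degree less than [p], and is [X^p] times a
    solution of degree less than [e1], a multiple of [u], for [z1]. *)
Lemma normalized_z_decomposition : exists al be ga de : k, [/\ be != 0, ga != 0,
  z1 = be *: w + al *: ('X^p * u) & z2 = ga *: u + de *: w].
Proof.
have le3 := normalized_e3_le; have leA := normalized_p_le; have hB := hb_B hb.
have h1 := normalized_hypergeom (or_introl erefl).
have h2 := normalized_hypergeom (or_intror erefl).
have ltA := hb_ltA hb.
have eq0 (z : {poly k}) : hypergeom z -> z`_0 = 0 -> z`_e1 = 0 ->
    forall i, (i < p)%N -> z`_i = 0.
  move=> hz h0 he i ip; have [lt|le] := ltnP i e1.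
    by apply: (hypergeom_eq0 hz h0 (t := e1)); first (by lia); move=> *; lia.
  apply: (hypergeom_eq0 hz he (leqnn p)) => [n|]; first by lia.
  by rewrite le.
have ue1 : u`_e1 = 0 by rewrite nth_default // (hb_size_u hb).
have w0 : w`_0 = 0 by rewrite (hb_w_low hb) //; lia.
pose ga := z2`_0 / u`_0; pose de := z2`_e1 / w`_e1.
pose be := z1`_e1 / w`_e1; pose y := z1 - be *: w.
pose al := (drop_poly p y)`_0 / u`_0.
exists al, be, ga, de; split.
- by rewrite mulf_neq0 ?invr_neq0 ?normalized_coef_e1 ?(hb_we1 hb).
- by rewrite mulf_neq0 ?invr_neq0 ?normalized_coef_0 ?(hb_u0 hb).
- have hy : hypergeom y by exact: hypergeomD h1 (hb_w hb).
  have y0 : forall i, (i < p)%N -> y`_i = 0.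
    apply: eq0 => //; rewrite coefB coefZ.
      by rewrite normalized_coef_low ?w0 ?mulr0 ?subrr //; lia.
    by rewrite divfK ?subrr // (hb_we1 hb).
  have yE : y = drop_poly p y * 'X^p.
    rewrite -{1}(poly_take_drop p y) (_ : take_poly _ _ = 0) ?add0r //.
    by apply/polyP => i; rewrite coef_take_poly coef0; case: ifP => // /y0.
  have dE : drop_poly p y - al *: u = 0.
    have hdr : hypergeom (drop_poly p y - al *: u).
      by apply: hypergeomD (hb_u hb); apply: hypergeom_drop.
    have sz : (size y <= A.+1)%N.
      rewrite (leq_trans (size_polyD _ _)) // geq_max size_normalized_z1 leqnn size_polyN /=.
      rewrite (leq_trans (size_scale_leq _ _)) // (hb_size_w hb) ltnS /A /B; lia.
    have e0 : (drop_poly p y - al *: u)`_0 = 0.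
      by rewrite coefB coefZ divfK ?subrr // (hb_u0 hb).
    have ne n : (0 <= n)%N -> (n.+1 < e1)%N -> (n.+1 != e1)%N by lia.
    apply/polyP => i; rewrite coef0; have [lt|le] := ltnP i e1.
      by apply: (hypergeom_eq0 hdr e0 _ ne); lia.
    rewrite coefB coefZ coef_drop_poly !nth_default ?mulr0 ?subr0 //.
      by rewrite (hb_size_u hb); lia.
    by apply: leq_trans sz _; lia.
  have -> : z1 = be *: w + y by rewrite addrC subrK.
  move/eqP: dE; rewrite subr_eq0 => /eqP dE.
  by rewrite {1}yE dE -scalerAl mulrC.
- apply/eqP; rewrite -subr_eq -subr_eq0; apply/eqP.
  set z := _ - _.
  have hz : hypergeom z by apply: hypergeomD (hb_u hb); apply: hypergeomD (hb_w hb).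
  have z0 : forall i, (i < p)%N -> z`_i = 0.
    apply: eq0 => //; rewrite !coefB !coefZ.
      by rewrite w0 mulr0 subr0 divfK ?subrr // (hb_u0 hb).
    by rewrite ue1 mulr0 subr0 divfK ?subrr // (hb_we1 hb).
  have sz : (size z <= p)%N.
    rewrite (leq_trans (size_polyD _ _)) // geq_max size_polyN; apply/andP; split.
      rewrite (leq_trans (size_polyD _ _)) // geq_max size_polyN size_normalized_z2.
      by rewrite (leq_trans (size_scale_leq _ _)) ?(hb_size_w hb); lia.
    by rewrite (leq_trans (size_scale_leq _ _)) ?(hb_size_u hb); lia.
  apply/polyP => i; rewrite coef0; have [/z0 //|le] := ltnP i p.
  by rewrite nth_default // (leq_trans sz).
Qed.

(** The Wronskian of [z1] and [z2] is that of [u] and [w] times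
    [al de X^p - be ga], which does not vanish at 1, since otherwise it would
    vanish there to order [p]. *)
Lemma hypergeom_basis_wronskian : exists2 c, c != 0 &
  wronskian u w = c *: ramification_poly mu 0.
Proof.
have le3 := normalized_e3_le; have leA := normalized_p_le; have hB := hb_B hb.
have ltA := hb_ltA hb.
have [al [be [ga [de [be0 ga0 E1 E2]]]]] := normalized_z_decomposition.
have [c c0 W] := normalized_wronskian.
pose D := (al * de) *: 'X^p - (be * ga)%:P.
have WE : wronskian z1 z2 = D * wronskian u w.
  rewrite E1 E2 /wronskian !(derivD, derivZ) deriv_Xp_mul /D -!mul_polyC !rmorphM /=.
  by ring.
have D1 : ~~ root D 1.
  apply/negP; rewrite /D rootE !hornerE expr1n mulr1 subr_eq0 => /eqP adE.
  have /dvdpP[G DE] : ('X - 1%:P) ^+ p %| D.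
    apply/dvdpP; exists (al * de)%:P; rewrite /D -adE.
    have pch : p \in [pchar {poly k}] by rewrite (rmorph_pchar polyC).
    rewrite -!(pFrobenius_autE pch) pFrobenius_autB_comm; last exact: mulrC.
    by rewrite !pFrobenius_autE expr1n -mul_polyC mulrBr mulr1.
  have := WE; rewrite W DE => e.
  have : ('X - 1%:P) ^+ e2 %| ramification_poly mu p.
    rewrite -(dvdpZr _ _ c0) e -mulrA mulrCA dvdp_mulr // dvdp_exp2l //; lia.
  rewrite /ramification_poly mulrAC mulrC.
  rewrite -{1}(prednK (ltnW (proj1 (andP he2)))) exprSr dvdp_mul2l ?expf_neq0 ?polyXsubC_eq0 //.
  rewrite dvdp_XsubCl rootE hornerM !horner_exp !hornerXsubC mulf_eq0 !expf_eq0.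
  by rewrite subr0 oner_eq0 subr_eq0 eq_sym (negPf (nc_mu1 nc)) !andbF.
have sR : size (ramification_poly mu 0) = (A - p + B)%N.
  by rewrite size_prod3 /A /B; lia.
have sW : size (wronskian u w) = (A - p + B)%N.
  by apply: size_wronskian (hb_size_u hb) (hb_size_w hb) _; apply: natr_neq; lia.
have [|||c' cE] := @dvdp_size_scale _ (ramification_poly mu 0) (wronskian u w).
- exact: prod3_neq0.
- apply: (dvdp_ramification_poly (nc_mu0 nc) (nc_mu1 nc)); rewrite ?expr0 ?dvd1p //.
  + rewrite wronskianC -dvdpNr opprK.
    apply: dvdp_wronskian; rewrite prednK; last by lia.
    apply/dvdpP; exists (drop_poly e1 w); rewrite subr0.
    rewrite -{1}(poly_take_drop e1 w) (_ : take_poly _ _ = 0) ?add0r //.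
    by apply/polyP => i; rewrite coef_take_poly coef0; case: ifP => // /(hb_w_low hb).
  + have : ('X - 1%:P) ^+ e2.-1 %| D * wronskian u w.
      by rewrite -WE W dvdpZr // /ramification_poly dvdp_mulr // dvdp_mull.
    by rewrite Gauss_dvdpr // coprimep_expl // coprimep_sym coprimep_XsubC.
- by rewrite sW sR.
exists c' => //; apply: contra_eq_neq cE => ->.
by rewrite scale0r -size_poly_eq0 sW; lia.
Qed.

(** Every normalized cover belongs to the family, and its fourth ramified point
    is admissible. *)
Lemma normalized_cover_in_family : admissible u w mu /\ exists2 c, c != 0 &
  P = c *: ((family_den u w mu).[1] *: family_num u w mu) /\
  Q = c *: ((family_num u w mu).[1] *: family_den u w mu).
Proof.
have mu0 := nc_mu0 nc; have mu1 := nc_mu1 nc.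
have [al [be [ga [de [be0 ga0 E1 E2]]]]] := normalized_z_decomposition.
have [c c0 W] := hypergeom_basis_wronskian.
have wr0 : (wronskian u w).[mu] != 0.
  rewrite W /ramification_poly expr0 mulr1 hornerZ hornerM !horner_exp !hornerXsubC subr0.
  by rewrite !mulf_neq0 // expf_neq0 // subr_eq0.
have z1mu : be * w.[mu] + al * (mu ^+ p * u.[mu]) = 0.
  have := congr1 (fun f => f.[mu]) E1; rewrite /z1.
  by rewrite hornerM hornerXsubC subrr mul0r hornerD !hornerZ hornerM hornerXn => <-.
have z2mu : ga * u.[mu] + de * w.[mu] = 0.
  have := congr1 (fun f => f.[mu]) E2; rewrite /z2.
  by rewrite hornerM hornerXsubC subrr mul0r hornerD !hornerZ => <-.
have uw : ~~ ((u.[mu] == 0) && (w.[mu] == 0)).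
  apply: contraNN wr0 => /andP[/eqP um /eqP wm].
  by rewrite /wronskian !hornerE um wm mul0r mulr0 subrr.
have um : u.[mu] != 0.
  apply: contraNneq uw => um; rewrite um eqxx /=; move/eqP: z1mu.
  by rewrite um !mulr0 addr0 mulf_eq0 (negPf be0).
have wm : w.[mu] != 0.
  apply: contraNneq uw => wm; rewrite wm eqxx andbT; move/eqP: z2mu.
  by rewrite wm mulr0 addr0 mulf_eq0 (negPf ga0).
have mup0 : mu ^+ p != 0 by rewrite expf_neq0.
pose c1 := be / (mu ^+ p * u.[mu]); pose c2 := - ga / w.[mu].
have c10 : c1 != 0 by rewrite mulf_neq0 ?invr_neq0 ?mulf_neq0.
have c20 : c2 != 0 by rewrite mulf_neq0 ?invr_neq0 ?oppr_eq0.
have X0 : 'X - mu%:P != 0 by rewrite polyXsubC_eq0.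
have PE : P = c1 *: family_num u w mu.
  apply: (mulfI X0); rewrite -scalerAr family_numE -/z1 E1 scalerBr !scalerA.
  congr (_ + _); first by rewrite /c1 divfK // mulf_neq0.
  rewrite -scaleNr; congr (_ *: _); apply: (mulIf (mulf_neq0 mup0 um)).
  rewrite mulNr mulrAC /c1 divfK ?mulf_neq0 //.
  by apply/eqP; rewrite -addr_eq0 addrC z1mu.
have QE : Q = c2 *: family_den u w mu.
  apply: (mulfI X0); rewrite -scalerAr family_denE -/z2 E2 scalerBr !scalerA addrC.
  congr (_ + _); last by rewrite /c2 divfK // scaleNr opprK.
  congr (_ *: _); apply: (mulIf wm); rewrite mulrAC /c2 divfK // mulNr.
  by apply/eqP; rewrite -addr_eq0 addrC z2mu.
have PQ1 : P.[1] = Q.[1].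
  apply/eqP; rewrite -subr_eq0 -hornerN -hornerD -rootE -dvdp_XsubCl.
  by apply: dvdp_trans (nc_one nc); rewrite dvdp_exp // ltnW //; case/andP: he2.
have Q1 := nc_Q1 nc; have P1 : P.[1] != 0 by rewrite PQ1.
have n1 : (family_num u w mu).[1] != 0.
  by apply: contraNneq P1 => e; rewrite PE hornerZ e mulr0.
have d1 : (family_den u w mu).[1] != 0.
  by apply: contraNneq Q1 => e; rewrite QE hornerZ e mulr0.
have cc : c1 * (family_num u w mu).[1] = c2 * (family_den u w mu).[1].
  by rewrite -!hornerZ -PE -QE.
have u1 : u.[1] != 0.
  apply: contraNneq (nc_lam1 nc) => u1; apply/eqP.
  have nd : (family_num u w mu).[1] = mu ^+ p * (family_den u w mu).[1].
    have h := congr1 (fun f => f.[1]) (family_numE u w mu).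
    have h' := congr1 (fun f => f.[1]) (family_denE u w mu).
    move: h h'; rewrite /= !hornerM !hornerXsubC !hornerD !hornerN !hornerZ hornerM u1.
    rewrite !mulr0 !subr0 => h h'.
    apply: (mulfI (_ : 1 - mu != 0)); first by rewrite subr_eq0 eq_sym.
    by rewrite h mulrCA h' mulrA.
  have lamE : c1 * mu ^+ p = lam * c2.
    apply: (mulIf wr0); rewrite -(mulrA c1) -family_num_mu -(mulrA lam) -family_den_mu.
    rewrite -(hornerZ c1) -PE -(hornerZ c2) -QE -hornerZ; apply/eqP.
    rewrite -subr_eq0 -hornerN -hornerD -rootE -dvdp_XsubCl.
    apply: dvdp_trans (nc_mu nc); rewrite dvdp_exp //.
    by rewrite -subn1 subn_gt0 prime_gt1.
  have : c1 * mu ^+ p = c2.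
    by apply: (mulIf d1); rewrite -mulrA -nd.
  by rewrite lamE => /(canRL (mulfK c20)); rewrite divff.
split; first by rewrite /admissible mu0 mu1 um wm u1 n1 d1.
exists (c1 / (family_den u w mu).[1]); first by rewrite mulf_neq0 ?invr_neq0.
rewrite !scalerA divfK // -PE; split=> //.
by rewrite mulrAC cc mulfK // -QE.
Qed.

End Decomposition.

End Normalized.

End Hypergeometric.

(** * The members of the family are covers *)

Section FiberMultiplicity.
Variable k : fieldType.
Implicit Types (F G P Q : {poly k}) (r : k).

(** Where the order of [F] is prime to the characteristic, the Wronskian
    vanishes to exactly one order less. *)
Lemma mup_wronskian r F G m : F != 0 -> mup r F = m.+1 -> ~~ root G r ->
  m.+1%:R != 0 :> k -> mup r (wronskian F G) = m.
Proof.
move=> F0 mF Gr m0; have [n [H]] := multiplicity_XsubC F r.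
rewrite F0 /= => Hr FE; have nE : n = m.+1.
  by rewrite -mF FE mupMr // mup_XsubCX eqxx.
rewrite FE nE.
have -> : wronskian (H * ('X - r%:P) ^+ m.+1) G = (('X - r%:P) * (H * G^`() - H^`() * G)
     - m.+1%:R * H * G) * ('X - r%:P) ^+ m.
  rewrite /wronskian derivM deriv_exp derivXsubC mul1r /= exprS -(mulr_natl (_ ^+ m)).
  by ring.
rewrite mupMr ?mup_XsubCX ?eqxx // rootE !hornerE subrr mul0r sub0r oppr_eq0.
by rewrite -polyC_natr hornerC; apply: mulf_neq0 Gr; apply: mulf_neq0 Hr.
Qed.

(** Where the order of [F] is zero in [k], no order is lost. *)
Lemma mup_wronskian_wild r F G m : F != 0 -> mup r F = m.+1 ->
  m.+1%:R = 0 :> k -> ('X - r%:P) ^+ m.+1 %| wronskian F G.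
Proof.
move=> F0 mF m0; have [n [H]] := multiplicity_XsubC F r.
rewrite F0 /= => Hr FE; have nE : n = m.+1.
  by rewrite -mF FE mupMr // mup_XsubCX eqxx.
rewrite FE nE /wronskian derivM deriv_exp derivXsubC mul1r -mulr_natr -polyC_natr m0.
by rewrite polyC0 !mulr0 addr0 dvdp_sub // dvdp_mulr // dvdp_mull.
Qed.

Lemma fiber_wronskian P Q r : (P.[r] != 0) || (Q.[r] != 0) ->
  exists G (s : k), [/\ s != 0, ~~ root G r &
    wronskian (Q.[r] *: P - P.[r] *: Q) G = s *: wronskian P Q].
Proof.
have E (a b : k) G : wronskian (a *: P - b *: Q) G = a *: wronskian P G - b *: wronskian Q G.
  by rewrite /wronskian derivB !derivZ -!mul_polyC; ring.
have D G : wronskian G G = 0 by rewrite /wronskian; ring.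
have [Q0|Q0] := eqVneq Q.[r] 0; rewrite ?orbF => P0.
  exists P, (P.[r]); split; rewrite ?rootE // E D scaler0 sub0r wronskianC scalerN opprK //.
by exists Q, (Q.[r]); split; rewrite ?rootE // E D scaler0 subr0.
Qed.

(** The multiplicity of a point in its fiber is read off the Wronskian, if the
    latter vanishes there to order less than [p - 1]: wild ramification of
    index [m] would force order at least [m >= p]. *)
Lemma mup_fiber (p : nat) P Q r : p \in [pchar k] ->
  (P.[r] != 0) || (Q.[r] != 0) -> wronskian P Q != 0 ->
  (mup r (wronskian P Q) < p.-1)%N ->
  mup r (Q.[r] *: P - P.[r] *: Q) = (mup r (wronskian P Q)).+1.
Proof.
move=> ch PQ W0 lt; have [G [s [s0 Gr WE]]] := fiber_wronskian PQ.
set F := _ - _ in WE *.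
have F0 : F != 0.
  apply: contra_neq W0 => F0; apply/eqP; move/esym/eqP: WE.
  by rewrite F0 /wronskian deriv0 !mul0r subrr scaler_eq0 (negPf s0).
have rF : (0 < mup r F)%N.
  by rewrite -XsubC_dvd // dvdp_XsubCl rootE /F !hornerE mulrC subrr.
have [m mF] : exists m, mup r F = m.+1 by exists (mup r F).-1; rewrite prednK.
have mE : mup r (wronskian F G) = mup r (wronskian P Q).
  by rewrite WE -mul_polyC mupMr // rootC.
have [m0|m0] := eqVneq (m.+1%:R : k) 0; last by rewrite mF -mE (mup_wronskian F0 mF).
have := mup_wronskian_wild G F0 mF m0.
rewrite WE dvdpZr // -mup_geq // => le.
have : (p <= m.+1)%N.
  by apply: dvdn_leq; rewrite // (dvdn_pcharf ch) m0.
by move: le lt; lia.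
Qed.

End FiberMultiplicity.

(** A common factor of the generic fiber [P - t Q] and its derivative divides
    the Wronskian of [P] and [Q], whose roots lie in [k]; but a root in [k] of
    [P - t Q] is a common root of [P] and [Q]. *)
Lemma separable_generic_fiber (k : fieldType) (f : ratmap k) (s : seq k) (c : k) :
  c != 0 -> wronskian f.1 f.2 = c *: \prod_(r <- s) ('X - r%:P) ->
  {in s, forall r, (f.1.[r] != 0) || (f.2.[r] != 0)} ->
  separable_poly (generic_fiber f).
Proof.
case: f => P Q c0 /= W PQ; rewrite /generic_fiber /=.
set phi := map_poly _; set t := tofrac 'X.
have phiE G : phi G = map_poly (@tofrac {poly k} \o polyC) G by [].
have dF : (phi P - t *: phi Q)^`() = phi P^`() - t *: phi Q^`().
  by rewrite derivB derivZ !phiE !deriv_map.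
have phiW : phi (wronskian P Q) =
    (phi P - t *: phi Q) * phi Q^`() - (phi P - t *: phi Q)^`() * phi Q.
  by rewrite dF phiE rmorphB !rmorphM /= -!phiE -!mul_polyC; ring.
have cop : coprimep (phi P - t *: phi Q) (phi (wronskian P Q)).
  rewrite W [phi (_ *: _)]phiE map_polyZ /= coprimepZr; last by rewrite tofrac_eq0 polyC_eq0.
  rewrite rmorph_prod /= big_seq.
  elim/big_rec: _ => [|r q /PQ nz cop]; first exact: coprimep1.
  rewrite coprimepMr cop andbT.
  rewrite rmorphB /= map_polyX map_polyC /= coprimep_XsubC.
  apply: contraTN nz; rewrite rootE hornerD hornerN hornerZ !phiE.
  have -> : tofrac r%:P = (@tofrac {poly k} \o polyC) r by [].
  rewrite !horner_map /= -rmorphM -rmorphB tofrac_eq0 => /eqP e.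
  rewrite negb_or !negbK; apply/andP; split; apply/eqP.
    by have := congr1 (fun g : {poly k} => g`_0) e; rewrite coefB coefXM !coefC /= subr0.
  have := congr1 (fun g : {poly k} => g`_1) e; rewrite coefB coefXM !coefC /= sub0r.
  by move=> /eqP; rewrite oppr_eq0 => /eqP.
rewrite separable_poly.unlock dF; apply/coprimepP => D DF DF'.
move/coprimepP: cop; apply=> //; rewrite phiW dF.
by rewrite dvdp_sub // dvdp_mulr.
Qed.
Section FamilyIsCover.
Variables (k : closedFieldType) (p : nat).
Hypotheses (p_prime : prime p) (p_odd : odd p) (char_k : p \in [pchar k]).
Variables (e1 e2 e3 d : nat).
Hypotheses (he1 : (1 < e1 < p)%N) (he2 : (1 < e2 < p)%N) (he3 : (1 < e3 < p)%N).
Hypothesis hd : (d.*2 + 3 = e1 + e2 + e3 + p)%N.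
Variables (u w : {poly k}) (c : k).
Hypothesis hb : hypergeom_basis p e1 e3 d u w.
Hypothesis c0 : c != 0.
Hypothesis wr : wronskian u w = c *: ('X^(e1.-1) * ('X - 1%:P) ^+ e2.-1).

(** The member of the family at [mu], normalized to take the value 1 at 1, and
    its value at [mu]. *)
Definition family_map (mu : k) : ratmap k :=
  ((family_den u w mu).[1] *: family_num p u w mu,
   (family_num p u w mu).[1] *: family_den u w mu).

Definition family_lambda (mu : k) : k :=
  mu ^+ p * (family_den u w mu).[1] / (family_num p u w mu).[1].

Variable mu : k.
Hypothesis adm : admissible p u w mu.

Let P := (family_map mu).1.
Let Q := (family_map mu).2.
Let n1 := (family_num p u w mu).[1].
Let d1 := (family_den u w mu).[1].

Let mu0 : mu != 0. Proof. by case/and5P: adm. Qed.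
Let mu1 : mu != 1. Proof. by case/and5P: adm. Qed.
Let um : u.[mu] != 0. Proof. by case/and5P: adm. Qed.
Let wm : w.[mu] != 0. Proof. by case/and5P: adm. Qed.
Let u1 : u.[1] != 0. Proof. by case/and5P: adm => _ _ _ _ /and3P[]. Qed.
Let n10 : n1 != 0. Proof. by case/and5P: adm => _ _ _ _ /and3P[]. Qed.
Let d10 : d1 != 0. Proof. by case/and5P: adm => _ _ _ _ /and3P[]. Qed.
Let mup0 : mu ^+ p != 0. Proof. by rewrite expf_neq0. Qed.
Let X0 : 'X - mu%:P != 0. Proof. by rewrite polyXsubC_eq0. Qed.
Let wrm : (wronskian u w).[mu] != 0.
Proof.
rewrite wr hornerZ hornerM !horner_exp hornerX hornerXsubC.
by rewrite !mulf_neq0 // expf_neq0 // subr_eq0.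
Qed.
Let w0 : w.[0] = 0.
Proof. by rewrite horner_coef0 (hb_w_low hb) //; case/andP: he1 => /ltnW. Qed.
Let u0 : u.[0] != 0. Proof. by rewrite horner_coef0 (hb_u0 hb). Qed.

Lemma size_family_num : size (family_num p u w mu) = d.+1.
Proof.
have hB := hb_B hb; have hA := hb_leA hb.
have Z0 : size (- (w.[mu] *: ('X^p * u))) = d.+2.
  rewrite size_polyN size_scale // mulrC size_mulXn -?size_poly_eq0 ?(hb_size_u hb) //.
  by rewrite addnS addnC subnK.
have Z : size (('X - mu%:P) * family_num p u w mu) = d.+2.
  rewrite family_numE addrC size_polyDl // Z0.
  by rewrite (leq_ltn_trans (size_scale_leq _ _)) // (hb_size_w hb); clear -hB hA he3; lia.
have N0 : family_num p u w mu != 0 by apply: contra_eq_neq Z => ->; rewrite mulr0 size_poly0.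
by move: Z; rewrite mulrC size_Mmonic ?monicXsubC // size_XsubC addn2 /= => -[].
Qed.

Lemma size_family_den : size (family_den u w mu) = (d.+1 - e3)%N.
Proof.
have hB := hb_B hb; have hA := hb_ltA hb.
have Z0 : size (u.[mu] *: w) = (d.+1 - e3).+1 by rewrite size_scale // (hb_size_w hb).
have Z : size (('X - mu%:P) * family_den u w mu) = (d.+1 - e3).+1.
  rewrite family_denE size_polyDl // Z0 size_polyN.
  by rewrite (leq_ltn_trans (size_scale_leq _ _)) // (hb_size_u hb); clear -hB hA he3; lia.
have N0 : family_den u w mu != 0 by apply: contra_eq_neq Z => ->; rewrite mulr0 size_poly0.
by move: Z; rewrite mulrC size_Mmonic ?monicXsubC // size_XsubC addn2 /= => -[].
Qed.

Let sP : size P = d.+1. Proof. by rewrite size_scale ?size_family_num. Qed.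
Let sQ : size Q = (d.+1 - e3)%N. Proof. by rewrite size_scale ?size_family_den. Qed.

Lemma family_wronskian : exists2 C, C != 0 &
  wronskian P Q = C *: ('X^(e1.-1) * ('X - 1%:P) ^+ e2.-1 * ('X - mu%:P) ^+ p.-2).
Proof.
exists (- d1 * n1 * w.[mu] * u.[mu] * c).
  by rewrite !mulf_neq0 // oppr_eq0.
apply: (mulfI (expf_neq0 2 X0)).
rewrite -wronskianMM -!scalerAr family_numE family_denE.
have pch : p \in [pchar {poly k}] by rewrite (rmorph_pchar polyC).
have XE : ('X - mu%:P) ^+ p = 'X^p - (mu ^+ p)%:P.
  by rewrite -!(pFrobenius_autE pch) pFrobenius_autB_comm ?pFrobenius_autE ?rmorphXn //; exact: mulrC.
have pE : p = (2 + p.-2)%N by have := prime_gt1 p_prime; clear; lia.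
transitivity ((- d1 * n1 * w.[mu] * u.[mu]) *: (wronskian u w * ('X - mu%:P) ^+ p)).
  rewrite wronskianZl wronskianZr XE.
  set B := mu ^+ p; rewrite /wronskian !(derivB, derivZ) (deriv_Xp_mul char_k).
  by rewrite -!mul_polyC !rmorphM rmorphN /=; ring.
have -> : ('X - mu%:P) ^+ p = ('X - mu%:P) ^+ 2 * ('X - mu%:P) ^+ p.-2.
  by rewrite -exprD -pE.
rewrite wr -!mul_polyC !rmorphM rmorphN /=; ring.
Qed.

Let P0 : P.[0] = 0.
Proof.
have := congr1 (fun f => f.[0]) (family_numE p u w mu); rewrite /= hornerM hornerXsubC sub0r.
rewrite hornerD hornerN !hornerZ w0 hornerM hornerXn expr0n gtn_eqF ?prime_gt0 // mul0r !mulr0 subrr.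
by move=> /eqP; rewrite mulf_eq0 oppr_eq0 (negPf mu0) /P /family_map /= ?hornerZ
  => /eqP ->; rewrite mulr0.
Qed.

Let Q0 : Q.[0] != 0.
Proof.
rewrite /Q /family_map /= ?hornerZ mulf_neq0 //.
have := congr1 (fun f => f.[0]) (family_denE u w mu); rewrite /= hornerM hornerXsubC sub0r.
rewrite hornerD hornerN !hornerZ w0 mulr0 sub0r => h.
by apply: contra_eq_neq h => ->; rewrite mulr0 eq_sym oppr_eq0 mulf_neq0.
Qed.

Let P1 : P.[1] = d1 * n1. Proof. by rewrite /P /family_map /= ?hornerZ. Qed.
Let Q1 : Q.[1] = d1 * n1. Proof. by rewrite /Q /family_map /= ?hornerZ mulrC. Qed.
Let Pm : P.[mu] = d1 * mu ^+ p * (wronskian u w).[mu].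
Proof. by rewrite /P /family_map /= ?hornerZ family_num_mu // mulrA. Qed.
Let Qm : Q.[mu] = n1 * (wronskian u w).[mu].
Proof. by rewrite /Q /family_map /= ?hornerZ family_den_mu. Qed.

Lemma family_no_common_zero r : (P.[r] != 0) || (Q.[r] != 0).
Proof.
have [C C0 W] := family_wronskian.
have [->|r0] := eqVneq r 0; first by rewrite Q0 orbT.
have [->|r1] := eqVneq r 1; first by rewrite P1 mulf_neq0.
have [->|rm] := eqVneq r mu; first by rewrite Qm mulf_neq0 ?orbT.
rewrite -negb_and; apply/negP => /andP[/eqP Pr /eqP Qr].
have Wr (F G : {poly k}) : F.[r] = 0 -> G.[r] = 0 -> (wronskian F G).[r] = 0.
  by rewrite /wronskian !hornerE => -> ->; rewrite mul0r mulr0 subrr.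
have := Wr _ _ Pr Qr; rewrite W => /eqP.
rewrite hornerZ !hornerM !horner_exp hornerX !hornerXsubC.
by rewrite !mulf_eq0 (negPf C0) !expf_eq0 !subr_eq0 (negPf r0) (negPf r1) (negPf rm) !andbF.
Qed.

Lemma mup_family_wronskian r : mup r (wronskian P Q) =
  ((r == 0)%R * e1.-1 + (r == 1)%R * e2.-1 + (r == mu)%R * p.-2)%N.
Proof.
have [C C0 ->] := family_wronskian.
have -> : 'X^(e1.-1) = ('X - 0%:P) ^+ e1.-1 :> {poly k} by rewrite subr0.
rewrite -mul_polyC mupMr ?rootC //.
rewrite !mupM ?mulf_neq0 ?expf_neq0 ?polyXsubC_eq0 // !mup_XsubCX ![_ == r]eq_sym.
by do 3!case: (_ == _); rewrite /= ?mul1n ?mul0n.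
Qed.

Let W0 : wronskian P Q != 0.
Proof.
have [C C0 ->] := family_wronskian.
by rewrite scaler_eq0 negb_or C0 !mulf_neq0 ?expf_neq0 ?polyXsubC_eq0 ?polyX_eq0.
Qed.

Lemma family_rdeg : rdeg (family_map mu) = d.
Proof. by rewrite /rdeg sP sQ (maxn_idPl _) // leq_subr. Qed.

Lemma family_ram_index r : ram_index (family_map mu) (Some r) =
  ((r == 0)%R * e1.-1 + (r == 1)%R * e2.-1 + (r == mu)%R * p.-2).+1%N.
Proof.
rewrite -mup_family_wronskian; apply: mup_fiber char_k _ W0 _.
  exact: family_no_common_zero.
rewrite mup_family_wronskian; have p1 := prime_gt1 p_prime.
have [->|r0] := eqVneq r 0;
  rewrite 1?[0 == 1]eq_sym ?oner_eq0 1?[0 == mu]eq_sym ?(negPf mu0).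
  by clear -he1 p1; lia.
have [->|r1] := eqVneq r 1; rewrite 1?[1 == mu]eq_sym ?(negPf mu1).
  by clear -he2 p1; lia.
by case: eqVneq => _; clear -p1; lia.
Qed.

Let Qd : Q`_d = 0. Proof. by rewrite nth_default // sQ; clear -he3; lia. Qed.
Let Pd : P`_d != 0. Proof. exact: coef_top_neq0. Qed.

Lemma family_ram_index_inf : ram_index (family_map mu) None = e3.
Proof.
rewrite /ram_index family_rdeg /fiber_form /= family_rdeg -/P -/Q Qd scale0r sub0r.
rewrite size_polyN size_scale // sQ; have := hb_B hb; clear -he1 he3; lia.
Qed.

Lemma family_value0 : value (family_map mu) (Some 0) = Some 0.
Proof. by rewrite /value /hom_point /= -/P -/Q P0 (negPf Q0) mul0r. Qed.

Lemma family_value1 : value (family_map mu) (Some 1) = Some 1.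
Proof.
have nz : d1 * n1 != 0 by rewrite mulf_neq0.
by rewrite /value /hom_point /= -/P -/Q P1 Q1 (negPf nz) divff.
Qed.

Lemma family_value_inf : value (family_map mu) None = None.
Proof. by rewrite /value /hom_point /= family_rdeg -/Q Qd eqxx. Qed.

Lemma family_value_mu : value (family_map mu) (Some mu) = Some (family_lambda mu).
Proof.
rewrite /value /hom_point /= -/P -/Q Pm Qm mulf_eq0 (negPf n10) (negPf wrm) /=.
by congr Some; rewrite /family_lambda -/n1 -/d1 -mulf_div divff // mulr1 [d1 * _]mulrC.
Qed.

Lemma family_lambda_neq0 : family_lambda mu != 0.
Proof. by rewrite !mulf_neq0 ?invr_neq0. Qed.

Lemma family_lambda_neq1 : family_lambda mu != 1.
Proof.
apply/eqP => /(canRL (divfK n10)); rewrite mul1r -/d1 -/n1 => e.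
have h := congr1 (fun f => f.[1]) (family_numE p u w mu).
have h' := congr1 (fun f => f.[1]) (family_denE u w mu).
move: h h'; rewrite /= !hornerM !hornerXsubC !hornerD !hornerN !hornerZ hornerM hornerXn expr1n mul1r.
rewrite -/n1 -/d1 => h h'.
have : (mu ^+ p - 1) * (w.[mu] * u.[1]) = 0.
  transitivity ((1 - mu) * n1 - mu ^+ p * ((1 - mu) * d1)).
    by rewrite h h'; ring.
  by rewrite -e; ring.
move=> /eqP; rewrite mulf_eq0 (negPf (mulf_neq0 wm u1)) orbF.
rewrite -(expr1n _ p) -!(pFrobenius_autE char_k) -pFrobenius_autB_comm; last exact: mulrC.
by rewrite pFrobenius_autE expf_eq0 subr_eq0 (negPf mu1) andbF.
Qed.

Lemma family_ramified x : (1 < ram_index (family_map mu) x)%N ->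
  [\/ x = Some 0, x = Some 1, x = None | x = Some mu].
Proof.
case: x => [r|]; last by move=> _; apply: Or43.
rewrite family_ram_index.
have [->|r0] := eqVneq r 0; first by move=> _; apply: Or41.
have [->|r1] := eqVneq r 1; first by move=> _; apply: Or42.
by have [->|rm] := eqVneq r mu => // _; apply: Or44.
Qed.

Lemma family_ram0 : ram_index (family_map mu) (Some 0) = e1.
Proof.
by rewrite family_ram_index eqxx [0 == 1]eq_sym oner_eq0 [0 == mu]eq_sym (negPf mu0); clear -he1; lia.
Qed.

Lemma family_ram1 : ram_index (family_map mu) (Some 1) = e2.
Proof.
by rewrite family_ram_index eqxx oner_eq0 [1 == mu]eq_sym (negPf mu1); clear -he2; lia.
Qed.

Lemma family_ram_mu : ram_index (family_map mu) (Some mu) = p.-1.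
Proof.
have p1 := prime_gt1 p_prime; have p2 := p_prime; have o := p_odd.
by rewrite family_ram_index eqxx (negPf mu0) (negPf mu1); clear -p1; lia.
Qed.

Lemma family_is_cover : is_cover (family_map mu).
Proof.
split.
- apply/Pdiv.ClosedField.coprimepP => r Pr.
  by have := family_no_common_zero r; rewrite -!rootE Pr.
- by rewrite family_rdeg; have := hb_leA hb; clear -he1; lia.
- have [C C0 W] := family_wronskian.
  apply: (@separable_generic_fiber _ _ (nseq e1.-1 0 ++ nseq e2.-1 1 ++ nseq p.-2 mu) C) => //.
    by rewrite W !big_cat /= !big_nseq !iter_mulr_1 subr0 mulrA.
  by move=> r _; exact: family_no_common_zero.
- move=> x; have ne n : (0 < n < p)%N -> n%:R != 0 :> k by apply: natr_neq0.
  have [le|/family_ramified[]->] := leqP (ram_index (family_map mu) x) 1.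
  + have -> : ram_index (family_map mu) x = 1%N; last by rewrite oner_eq0.
    apply/eqP; rewrite eqn_leq le; case: x {le} => [r|]; first by rewrite family_ram_index.
    by rewrite family_ram_index_inf; clear -he3; lia.
  + by rewrite family_ram0 ne //; clear -he1 he2 he3; lia.
  + by rewrite family_ram1 ne //; clear -he1 he2 he3; lia.
  + by rewrite family_ram_index_inf ne //; clear -he1 he2 he3; lia.
  + by rewrite family_ram_mu ne //; clear -he1 he2 he3; lia.
Qed.

Lemma family_ramification_type :
  has_ramification_type d [tuple e1; e2; e3; p.-1] (family_lambda mu) (family_map mu).
Proof.
have l0 := family_lambda_neq0; have l1 := family_lambda_neq1.
have p1 : (1 < p.-1)%N by clear -p_odd he1; lia.
pose x := [tuple Some 0; Some 1; None; Some mu] : 4.-tuple (proj_line k).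
have vx i : value (family_map mu) (tnth x i) = tnth (branch_points (family_lambda mu)) i.
  case: i => [[|[|[|[|//]]]] i4]; rewrite !(tnth_nth None) /=.
  - exact: family_value0.
  - exact: family_value1.
  - exact: family_value_inf.
  - exact: family_value_mu.
have rx i : ram_index (family_map mu) (tnth x i) = tnth [tuple e1; e2; e3; p.-1] i.
  case: i => [[|[|[|[|//]]]] i4]; rewrite (tnth_nth None) (tnth_nth 0) /=.
  - exact: family_ram0.
  - exact: family_ram1.
  - exact: family_ram_index_inf.
  - exact: family_ram_mu.
have e_gt1 i : (1 < tnth [tuple e1; e2; e3; p.-1] i)%N.
  by case: i => [[|[|[|[|//]]]] i4]; rewrite (tnth_nth 0) /=; clear -p1 he1 he2 he3; lia.
have inj : injective (tnth (branch_points (family_lambda mu))).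
  apply/tuple_uniqP; rewrite /= !inE /= !andbT.
  by rewrite !(inj_eq Some_inj) ![0 == _]eq_sym ![1 == family_lambda mu]eq_sym
       oner_eq0 (negPf l0) (negPf l1).
have rr y : (1 < ram_index (family_map mu) y)%N -> exists i, y = tnth x i.
  by move=> /family_ramified[]->; [exists 0|exists 1|exists 2%:R|exists 3%:R]; rewrite (tnth_nth None).
split.
- exact: family_is_cover.
- exact: family_rdeg.
- move=> y; split=> [[z zy /rr[i zE]]|[i ->]].
    by exists i; rewrite -zy zE vx.
  by exists (tnth x i); rewrite ?vx // rx.
- move=> i; exists (tnth x i); split=> // z zv /rr[j zE].
  by move: zv; rewrite zE vx => /inj ->.
Qed.

End FamilyIsCover.

(** * Binary forms and automorphisms of the source *)

Lemma det_mx2 (R : comNzRingType) (A : 'M[R]_2) :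
  \det A = A ord0 ord0 * A ord_max ord_max - A ord0 ord_max * A ord_max ord0.
Proof.
rewrite (expand_det_row _ ord0) !big_ord_recl big_ord0 addr0.
rewrite /cofactor !det_mx11 !mxE /= !expr0 expr1.
have -> : lift ord0 ord0 = ord_max :> 'I_2 by apply: val_inj.
have -> : lift ord_max ord0 = ord0 :> 'I_2 by apply: val_inj.
by ring.
Qed.

Section BinaryForms.
Variable k : fieldType.
Implicit Types (F G : {poly k}) (x y : proj_line k) (A : 'M[k]_2).

(** The value at a point of the projective line of a polynomial seen as a
    binary form of degree [d]. *)
Definition form_value (d : nat) F x : k := if x is Some a then F.[a] else F`_d.

(** A linear form vanishing at [x] exactly. The second variable, set to 1,
    represents it up to sign at infinity. *)
Definition point_form x : {poly k} := if x is Some a then 'X - a%:P else -1.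

(** The binary form [F] of degree [d] vanishes at [x] to order [m] exactly. *)
Definition has_order (d m : nat) x F := exists G,
  [/\ (size G + m <= d.+1)%N, F = point_form x ^+ m * G & form_value (d - m) G x != 0].

Let hx x := hom_coord x ord0 ord0.
Let hy x := hom_coord x ord_max ord0.

Lemma point_formE x : point_form x = hy x *: 'X - (hx x)%:P.
Proof.
by case: x => [a|]; rewrite /hx /hy !mxE /= ?scale1r // scale0r sub0r polyC1.
Qed.

(** The binary form of degree [d] attached to [F]. *)
Definition form_eval (d : nat) F (s t : k) := \sum_(i < d.+1) F`_i * (s ^+ i * t ^+ (d - i)).

Lemma form_valueE d F x : (size F <= d.+1)%N -> form_value d F x = form_eval d F (hx x) (hy x).
Proof.
move=> sF; case: x => [a|]; rewrite /hx /hy !mxE /=.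
  by rewrite (horner_coef_wide _ sF); apply: eq_bigr => i _; rewrite expr1n mulr1.
rewrite /form_eval big_ord_recr /= expr1n mul1r subnn expr0 mulr1 big1 ?add0r // => i _.
by rewrite expr0n subn_eq0 leqNgt ltn_ord !mulr0.
Qed.

Lemma form_evalZ d F (c s t : k) : form_eval d F (c * s) (c * t) = c ^+ d * form_eval d F s t.
Proof.
rewrite /form_eval big_distrr; apply: eq_bigr => i _ /=.
rewrite !exprMn [RHS]mulrCA; congr (_ * _).
rewrite mulrACA -exprD; congr (c ^+ _ * _).
by rewrite subnKC // -ltnS.
Qed.

(** The linear substitution of matrix [A] in the binary form [F] of degree
    [d]. *)
Definition form_subst (d : nat) A F : {poly k} := \sum_(i < d.+1) F`_i *:
  ((A ord0 ord0 *: 'X + (A ord0 ord_max)%:P) ^+ i *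
   (A ord_max ord0 *: 'X + (A ord_max ord_max)%:P) ^+ (d - i)).

Lemma linear_size (a b : k) : (size (a *: 'X + b%:P : {poly k})%R <= 2)%N.
Proof.
rewrite (leq_trans (size_polyD _ _)) // geq_max (leq_trans (size_scale_leq _ _)) ?size_polyX //=.
by rewrite (leq_trans (size_polyC_leq1 _)).
Qed.

Lemma linear_exp (a b : k) n : (size ((a *: 'X + b%:P : {poly k}) ^+ n)%R <= n.+1)%N /\
  ((a *: 'X + b%:P : {poly k}) ^+ n)`_n = a ^+ n.
Proof.
elim: n => [|n [IHs IHc]]; first by rewrite expr0 size_poly1 coefC.
have s2 := linear_size a b; rewrite exprS; split; first exact: (size_mul_le s2 IHs).
rewrite -add1n (coef_mul_top s2 IHs) IHc add1n exprS.
by rewrite coefD coefZ coefX coefC /= mulr1 addr0.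
Qed.

Lemma size_form_subst d A F : (size (form_subst d A F) <= d.+1)%N.
Proof.
apply: (big_ind (fun f : {poly k} => size f <= d.+1)%N) => [|f g sf sg|i _].
- by rewrite size_poly0.
- by rewrite (leq_trans (size_polyD _ _)) // geq_max sf.
- rewrite (leq_trans (size_scale_leq _ _)) //.
  have [s1 _] := linear_exp (A ord0 ord0) (A ord0 ord_max) i.
  have [s2 _] := linear_exp (A ord_max ord0) (A ord_max ord_max) (d - i).
  by rewrite (leq_trans (size_mul_le s1 s2)) // subnKC // -ltnS.
Qed.

Lemma form_substB d A F G : form_subst d A (F - G) = form_subst d A F - form_subst d A G.
Proof.
by rewrite /form_subst -sumrB; apply: eq_bigr => i _; rewrite coefB scalerBl.
Qed.

Lemma form_substZ d A (c : k) F : form_subst d A (c *: F) = c *: form_subst d A F.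
Proof.
by rewrite /form_subst scaler_sumr; apply: eq_bigr => i _; rewrite coefZ scalerA.
Qed.

Lemma mulmx_coord A x : (A *m hom_coord x) ord0 ord0 = A ord0 ord0 * hx x + A ord0 ord_max * hy x
  /\ (A *m hom_coord x) ord_max ord0 = A ord_max ord0 * hx x + A ord_max ord_max * hy x.
Proof.
by rewrite !mxE !big_ord_recr !big_ord0 /= !add0r; split; congr (_ * _ + _ * _);
   congr (fun_of_matrix _ _ _); apply: val_inj.
Qed.

Lemma form_value_subst_eval d A F y :
  form_value d (form_subst d A F) y =
    form_eval d F ((A *m hom_coord y) ord0 ord0) ((A *m hom_coord y) ord_max ord0).
Proof.
have [-> ->] := mulmx_coord A y; rewrite /form_eval /form_subst.
case: y => [a|] /=; rewrite /hx /hy !mxE /=.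
  rewrite horner_sum; apply: eq_bigr => i _.
  by rewrite hornerZ hornerM !horner_exp !hornerD !hornerZ hornerX !hornerC !mulr1.
rewrite coef_sum; apply: eq_bigr => i _; rewrite coefZ !mulr1 !mulr0 !addr0.
have [s1 c1] := linear_exp (A ord0 ord0) (A ord0 ord_max) i.
have [s2 c2] := linear_exp (A ord_max ord0) (A ord_max ord_max) (d - i).
have id : (i + (d - i) = d)%N by rewrite subnKC // -ltnS.
by have := coef_mul_top s1 s2; rewrite id c1 c2 => ->.
Qed.

Lemma moebius_coord A y : A \in unitmx -> exists2 c, c != 0 &
  hom_coord (moebius A y) = c *: (A *m hom_coord y).
Proof.
move=> uA; apply: hom_coordK; apply: contra_neq (hom_coord_neq0 y) => e.
by rewrite -(mulKmx uA (hom_coord y)) e mulmx0.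
Qed.

Lemma form_value_subst A y : A \in unitmx -> exists2 c, c != 0 & forall d F,
  (size F <= d.+1)%N -> form_value d (form_subst d A F) y = c ^+ d * form_value d F (moebius A y).
Proof.
move=> uA; have [c c0 e] := moebius_coord y uA.
exists c^-1 => [|d F sF]; first by rewrite invr_eq0.
rewrite form_value_subst_eval form_valueE // -form_evalZ.
congr form_eval; rewrite /hx /hy e [in RHS]mxE mulrA mulVf ?mul1r //.
Qed.

(** The linear substitution of matrix [A] in [point_form x]. *)
Definition point_form_subst A x : {poly k} :=
  hy x *: (A ord0 ord0 *: 'X + (A ord0 ord_max)%:P) -
  hx x *: (A ord_max ord0 *: 'X + (A ord_max ord_max)%:P).

Lemma form_substM d A x G : (size G <= d.+1)%N ->
  form_subst d.+1 A (point_form x * G) = point_form_subst A x * form_subst d A G.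
Proof.
move=> sG; rewrite /point_form_subst.
set l1 := _ *: 'X + _; set l2 := _ *: 'X + _.
have E1 : form_subst d.+1 A ('X * G) = l1 * form_subst d A G.
  rewrite /form_subst big_ord_recl coefXM /= scale0r add0r big_distrr.
  apply: eq_bigr => i _ /=; rewrite coefXM /= /bump /= add1n subSS exprS.
  by rewrite -mulrA scalerAr.
have E2 : form_subst d.+1 A G = l2 * form_subst d A G.
  rewrite /form_subst big_ord_recr /= nth_default // scale0r addr0 big_distrr.
  apply: eq_bigr => i _ /=; rewrite subSn; last by rewrite -ltnS.
  by rewrite exprS mulrCA scalerAr.
rewrite point_formE mulrBl -scalerAl mul_polyC form_substB !form_substZ E1 E2.
by rewrite mulrBl -!scalerAl.
Qed.

Lemma point_form_subst_moebius A y : A \in unitmx -> exists2 c, c != 0 &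
  point_form_subst A (moebius A y) = c *: point_form y.
Proof.
move=> uA; have [c c0 e] := moebius_coord y uA.
exists (c * \det A); first by rewrite mulf_neq0 // -unitfE -unitmxE.
rewrite /point_form_subst /hx /hy e !mxE.
have [] := mulmx_coord A y; rewrite !mxE => -> ->.
rewrite point_formE det_mx2.
rewrite -!mul_polyC !(rmorphM, rmorphD, rmorphN) /=.
by ring.
Qed.

Lemma has_order_subst d m A y F : A \in unitmx ->
  has_order d m (moebius A y) F -> has_order d m y (form_subst d A F).
Proof.
move=> uA [G [sG -> vG]]; have [c c0 e] := point_form_subst_moebius y uA.
have G0 : (0 < size G)%N.
  rewrite size_poly_gt0; apply: contraNneq vG => ->.
  by case: (moebius A y) => [a|] /=; rewrite ?horner0 ?coef0.
have md : (m <= d)%N by move: sG; rewrite -(prednK G0) addSn ltnS; apply: leq_trans; rewrite leq_addl.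
have sG' : (size G <= (d - m).+1)%N by rewrite -subSn // leq_subRL 1?addnC // (leq_trans md).
have E n : form_subst (n + (d - m)) A (point_form (moebius A y) ^+ n * G) =
    point_form_subst A (moebius A y) ^+ n * form_subst (d - m) A G /\
    (size (point_form (moebius A y) ^+ n * G)%R <= (n + (d - m)).+1)%N.
  elim: n => [|n [IHn IHs]]; first by rewrite !expr0 !mul1r add0n.
  rewrite addSn !exprS -mulrA form_substM // IHn mulrA; split=> //.
  apply: (size_mul_le (m := 1) _ IHs).
  by case: (moebius A y) => [a|] /=; rewrite ?size_XsubC // size_polyN size_poly1.
exists (c ^+ m *: form_subst (d - m) A G); split.
- rewrite size_scale ?expf_neq0 //.
  by rewrite (leq_trans (leq_add (size_form_subst _ _ _) (leqnn m))) // addSn subnK.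
- by rewrite -{1}(subnKC md) (E m).1 e exprZn -scalerAl scalerAr.
- have [c' c'0 vE] := form_value_subst y uA.
  have -> : form_value (d - m) (c ^+ m *: form_subst (d - m) A G) y =
      c ^+ m * form_value (d - m) (form_subst (d - m) A G) y.
    by case: (y) => [a|] /=; rewrite ?hornerZ ?coefZ.
  by rewrite vE // !mulf_neq0 ?expf_neq0.
Qed.

Lemma has_orderZ d m x (c : k) F : c != 0 -> has_order d m x (c *: F) -> has_order d m x F.
Proof.
move=> c0 [G [sG FE vG]]; exists (c^-1 *: G); split.
- by rewrite size_scale ?invr_eq0.
- by rewrite -scalerAr -FE scalerA mulVf ?scale1r.
- have -> : form_value (d - m) (c^-1 *: G) x = c^-1 * form_value (d - m) G x.
    by case: (x) => [a|] /=; rewrite ?hornerZ ?coefZ.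
  by rewrite mulf_neq0 ?invr_eq0.
Qed.

Lemma has_order_dvdp d m (a : k) F : has_order d m (Some a) F -> ('X - a%:P) ^+ m %| F.
Proof. by move=> [G [_ -> _]]; rewrite dvdp_mulr. Qed.

Lemma has_order_inf d m F : has_order d m None F -> (size F + m = d.+1)%N.
Proof.
move=> [G [sG -> /= vG]].
have -> : size ((-1) ^+ m * G)%R = size G.
  by rewrite -polyC1 -polyCN -polyC_exp mul_polyC size_scale // expf_neq0 // oppr_eq0 oner_eq0.
have lt : (d - m < size G)%N by rewrite ltnNge; apply: contraNN vG => /(nth_default 0) ->.
by clear -lt sG; lia.
Qed.

End BinaryForms.
Section Normalization.
Variable k : fieldType.

(** The determinant of the homogeneous coordinates of two points. *)
Definition coord_det (x y : proj_line k) : k :=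
  hom_coord x ord0 ord0 * hom_coord y ord_max ord0 -
  hom_coord x ord_max ord0 * hom_coord y ord0 ord0.

Lemma coord_det_neq0 x y : x != y -> coord_det x y != 0.
Proof.
rewrite /coord_det !mxE; case: x y => [a|] [b|] //=.
- by rewrite mulr1 mul1r subr_eq0; apply: contra_neq => ->.
- by move=> _; rewrite mulr0 mul1r sub0r oppr_eq0 oner_eq0.
- by move=> _; rewrite mulr1 mul0r subr0 oner_eq0.
Qed.

(** The automorphisms of the projective line act transitively on the triples
    of distinct points. *)
Lemma moebius_transitive (x1 x2 x3 : proj_line k) :
  x1 != x2 -> x1 != x3 -> x2 != x3 ->
  exists2 A : 'M[k]_2, A \in unitmx &
    [/\ moebius A (Some 0) = x1, moebius A (Some 1) = x2 & moebius A None = x3].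
Proof.
move=> n12 n13 n23.
have al0 : coord_det x2 x1 != 0 by rewrite coord_det_neq0 // eq_sym.
have be0 : coord_det x3 x2 != 0 by rewrite coord_det_neq0 // eq_sym.
have ga0 : coord_det x3 x1 != 0 by rewrite coord_det_neq0 // eq_sym.
pose al := coord_det x2 x1; pose be := coord_det x3 x2.
pose A : 'M[k]_2 := \matrix_(i, j) if j == ord0 then al * hom_coord x3 i ord0
   else be * hom_coord x1 i ord0.
have AE i j : A i j = if j == ord0 then al * hom_coord x3 i ord0
    else be * hom_coord x1 i ord0 by rewrite mxE.
have mE y : moebius A y = hom_point
   (al * hom_coord x3 ord0 ord0 * hom_coord y ord0 ord0 +
    be * hom_coord x1 ord0 ord0 * hom_coord y ord_max ord0)
   (al * hom_coord x3 ord_max ord0 * hom_coord y ord0 ord0 +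
    be * hom_coord x1 ord_max ord0 * hom_coord y ord_max ord0).
  by rewrite /moebius; have [-> ->] := mulmx_coord A y; rewrite !AE.
have hS (a : k) : hom_coord (Some a) ord0 ord0 = a by rewrite mxE.
have hS' (a : k) : hom_coord (Some a) ord_max ord0 = 1 by rewrite mxE.
have hN : hom_coord (None : proj_line k) ord0 ord0 = 1 by rewrite mxE.
have hN' : hom_coord (None : proj_line k) ord_max ord0 = 0 by rewrite mxE.
exists A.
  rewrite unitmxE unitfE det_mx2 !AE /=.
  suff -> : al * hom_coord x3 ord0 ord0 * (be * hom_coord x1 ord_max ord0) -
      be * hom_coord x1 ord0 ord0 * (al * hom_coord x3 ord_max ord0) =
      al * be * coord_det x3 x1 by rewrite !mulf_neq0.
  by rewrite /coord_det; ring.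
split; rewrite mE ?hS ?hS' ?hN ?hN'.
- by rewrite !mulr0 !mulr1 !add0r hom_pointZ // hom_pointK.
- rewrite !mulr1.
  (* the Pluecker relation between the coordinates of three points *)
  have E i : al * hom_coord x3 i ord0 + be * hom_coord x1 i ord0 =
      coord_det x3 x1 * hom_coord x2 i ord0.
    have [->|->] : i = ord0 \/ i = ord_max.
      by case: i => [[|[|//]] i2]; [left|right]; apply: val_inj.
    - by rewrite /al /be /coord_det; ring.
    - by rewrite /al /be /coord_det; ring.
  by rewrite !E hom_pointZ // hom_pointK.
- by rewrite !mulr0 !mulr1 !addr0 hom_pointZ // hom_pointK.
Qed.

Lemma form_value_neq0 (P Q : {poly k}) x : coprimep P Q ->
  (form_value (rdeg (P, Q)) P x != 0) || (form_value (rdeg (P, Q)) Q x != 0).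
Proof.
case: x => [a|] cop /=.
  rewrite -negb_and; apply/negP => /andP[Pa Qa].
  by have := coprimep_root cop Pa; rewrite (negPf (_ : ~~ (Q.[a] != 0))) ?negbK.
have nz (F : {poly k}) : F != 0 -> F`_(size F).-1 != 0 by rewrite -lead_coefE lead_coef_eq0.
rewrite /rdeg /=; case: (leqP (size P) (size Q)) => le.
  rewrite nz ?orbT //; apply: contraTneq cop => Q0.
  by move: le; rewrite Q0 size_poly0 leqn0 size_poly_eq0 => /eqP ->; rewrite coprimep0 eqp01.
by rewrite nz // -size_poly_eq0; case: (size P) le.
Qed.

Lemma size_rdeg (P Q : {poly k}) : (0 < rdeg (P, Q))%N ->
  (size P <= (rdeg (P, Q)).+1)%N /\ (size Q <= (rdeg (P, Q)).+1)%N.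
Proof.
rewrite /rdeg /= => h; rewrite prednK; last by case: maxn h.
by rewrite leq_maxl leq_maxr.
Qed.

Lemma coprimep_combination_neq0 (P Q : {poly k}) (a b : k) : coprimep P Q ->
  (0 < rdeg (P, Q))%N -> (a != 0) || (b != 0) -> b *: P - a *: Q != 0.
Proof.
move=> cop dg ab; apply/negP; rewrite subr_eq0 => /eqP e.
have s1 (F G : {poly k}) (x y : k) : coprimep F G -> x != 0 -> x *: F = y *: G ->
    (size F <= 1)%N /\ (size G <= 1)%N.
  move=> cFG x0 /(congr1 (fun f => x^-1 *: f)); rewrite !scalerA mulVf // scale1r => FE.
  have sG : size G == 1%N.
    by move: cFG; rewrite FE coprimep_sym => /coprimepP/(_ G) h;
       rewrite size_poly_eq1 h // -mul_polyC dvdp_mull.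
  by rewrite FE (leq_trans (size_scale_leq _ _)) (eqP sG).
have [sP sQ] : (size P <= 1)%N /\ (size Q <= 1)%N.
  have [b0|] := eqVneq b 0; last by move=> b0; exact: s1 cop b0 e.
  move: ab; rewrite b0 eqxx orbF => a0.
  by rewrite coprimep_sym in cop; have [] := s1 _ _ _ _ cop a0 (esym e).
have : (maxn (size P) (size Q) <= 1)%N by rewrite geq_max sP.
by move: dg; rewrite /rdeg /=; clear; lia.
Qed.

(** The ramification index is the order of vanishing of the fiber form. *)
Lemma has_order_ram_index (P Q : {poly k}) (x : proj_line k) :
  coprimep P Q -> (0 < rdeg (P, Q))%N ->
  has_order (rdeg (P, Q)) (ram_index (P, Q) x) x (fiber_form (P, Q) x).
Proof.
move=> cop dg; set d := rdeg (P, Q).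
have F0 : fiber_form (P, Q) x != 0.
  apply: coprimep_combination_neq0 => //.
  by have := form_value_neq0 x cop; case: (x) => [a|].
have [sP sQ] := size_rdeg dg.
have sF : (size (fiber_form (P, Q) x) <= d.+1)%N.
  rewrite (leq_trans (size_polyD _ _)) // geq_max size_polyN.
  by rewrite !(leq_trans (size_scale_leq _ _)).
move: F0 sF; case: x => [a|]; rewrite /ram_index.
  set F := fiber_form _ _ => F0 sF; have [m [H]] := multiplicity_XsubC F a.
  rewrite F0 /= => Ha FE.
  have H0 : H != 0 by apply: contraNneq Ha => ->; rewrite root0.
  have -> : mup a F = m by rewrite FE mupMr // mup_XsubCX eqxx.
  exists H; split=> //; last by rewrite FE mulrC.
  move: sF; rewrite FE size_Mmonic ?rpredX ?monicXsubC // size_exp_XsubC.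
  by rewrite addnS.
rewrite -/d; set F := fiber_form _ _ => F0 sF.
have sF0 : (0 < size F)%N by rewrite size_poly_gt0.
have nz n : (-1) ^+ n != 0 :> k by rewrite expf_neq0 // oppr_eq0 oner_eq0.
exists ((-1) ^+ (d - (size F).-1) *: F); split.
- rewrite size_scale //; case: (size F) sF sF0 => // n nd _.
  by rewrite /= addSn subnKC.
- rewrite /= -scalerAr -polyC1 -polyCN -polyC_exp mul_polyC scalerA -exprMn.
  by rewrite mulrNN mulr1 expr1n scale1r.
- rewrite /= coefZ mulf_neq0 // subKn; last by case: (size F) sF.
  by rewrite -lead_coefE lead_coef_eq0.
Qed.

Lemma hom_valueE (f : ratmap k) x :
  hom_value f x = (form_value (rdeg f) f.1 x, form_value (rdeg f) f.2 x).
Proof. by case: x. Qed.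

Lemma value_Some (f : ratmap k) x (a : k) : value f x = Some a ->
  form_value (rdeg f) f.2 x != 0 /\
  form_value (rdeg f) f.1 x = a * form_value (rdeg f) f.2 x.
Proof.
rewrite /value hom_valueE /= /hom_point; case: eqVneq => // h [<-].
by split; rewrite ?divfK.
Qed.

Lemma value_None (f : ratmap k) x : value f x = None -> form_value (rdeg f) f.2 x = 0.
Proof. by rewrite /value hom_valueE /= /hom_point; case: eqVneq. Qed.

(** Every cover becomes normalized after an automorphism of the source. *)
Lemma normalize_cover (p d e1 e2 e3 : nat) (lam : k) (f : ratmap k) :
  (0 < e3)%N -> lam != 0 -> lam != 1 ->
  has_ramification_type d [tuple e1; e2; e3; p.-1] lam f ->
  exists mu P Q, normalized_cover p d e1 e2 e3 mu lam P Q /\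
    exists2 A : 'M[k]_2, A \in unitmx & forall x, value f (moebius A x) = value (P, Q) x.
Proof.
case: f => P Q e30 l0 l1 [[cop dg _ _] dE _ ram].
have [sP sQ] := size_rdeg dg; rewrite dE in sP sQ.
have [x1 [v1 r1 _]] := ram ord0; have [x2 [v2 r2 _]] := ram 1.
have [x3 [v3 r3 _]] := ram 2%:R; have [x4 [v4 r4 _]] := ram 3%:R.
have {}v1 : value (P, Q) x1 = Some 0 by rewrite v1 (tnth_nth None).
have {}v2 : value (P, Q) x2 = Some 1 by rewrite v2 (tnth_nth None).
have {}v3 : value (P, Q) x3 = None by rewrite v3 (tnth_nth None).
have {}v4 : value (P, Q) x4 = Some lam by rewrite v4 (tnth_nth None).
have {}r1 : ram_index (P, Q) x1 = e1 by rewrite r1 (tnth_nth 0%N).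
have {}r2 : ram_index (P, Q) x2 = e2 by rewrite r2 (tnth_nth 0%N).
have {}r3 : ram_index (P, Q) x3 = e3 by rewrite r3 (tnth_nth 0%N).
have {}r4 : ram_index (P, Q) x4 = p.-1 by rewrite r4 (tnth_nth 0%N).
have dist x y : value (P, Q) x <> value (P, Q) y -> x != y.
  by move=> ne; apply/eqP => e; apply: ne; rewrite e.
have n12 : x1 != x2.
  by apply: dist; rewrite v1 v2 => -[/esym/eqP]; rewrite oner_eq0.
have n13 : x1 != x3 by apply: dist; rewrite v1 v3.
have n23 : x2 != x3 by apply: dist; rewrite v2 v3.
have n41 : x4 != x1 by apply: dist; rewrite v4 v1 => -[/eqP]; rewrite (negPf l0).
have n42 : x4 != x2 by apply: dist; rewrite v4 v2 => -[/eqP]; rewrite (negPf l1).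
have n43 : x4 != x3 by apply: dist; rewrite v4 v3.
have [A uA [A0 A1 Ainf]] := moebius_transitive n12 n13 n23.
have [mu Amu] : exists mu, moebius A (Some mu) = x4.
  have yE : moebius A (moebius (invmx A) x4) = x4.
    by rewrite -moebiusM ?unitmx_inv // mulmxV // moebius1.
  case yy : (moebius (invmx A) x4) yE => [mu|] yE; first by exists mu.
  by move: n43; rewrite -yE -Ainf eqxx.
have fiber y (m : nat) x : moebius A y = x -> ram_index (P, Q) x = m ->
    has_order d m y (form_subst d A (fiber_form (P, Q) x)).
  move=> Ay <-; apply: has_order_subst uA _; rewrite Ay -dE.
  exact: has_order_ram_index.
have order_Some y (m : nat) x (a : k) : moebius A y = x -> ram_index (P, Q) x = m ->
    value (P, Q) x = Some a ->
    has_order d m y (form_subst d A P - a *: form_subst d A Q).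
  move=> Ay rx vx; have [b0 bE] := value_Some vx.
  have := fiber _ _ _ Ay rx; rewrite /fiber_form hom_valueE /= in b0 bE *.
  rewrite bE form_substB !form_substZ mulrC -scalerA -scalerBr.
  exact: has_orderZ.
have order_None y (m : nat) x : moebius A y = x -> ram_index (P, Q) x = m ->
    value (P, Q) x = None -> has_order d m y (form_subst d A Q).
  move=> Ay rx vx; have b0 := value_None vx.
  have := form_value_neq0 x cop; rewrite [X in _ || (X != 0)]b0 eqxx orbF => a0.
  have := fiber _ _ _ Ay rx; rewrite /fiber_form hom_valueE /= in b0 a0 *.
  rewrite b0 scale0r sub0r -scaleNr form_substZ.
  by apply: has_orderZ; rewrite oppr_eq0.
have valueE y : exists2 c, c != 0 &
    (form_value d (form_subst d A P) y = c * form_value d P (moebius A y)) /\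
    (form_value d (form_subst d A Q) y = c * form_value d Q (moebius A y)).
  have [c c0 h] := form_value_subst y uA.
  by exists (c ^+ d); rewrite ?expf_neq0 // !h.
have Q_neq0 y x (a : k) : moebius A y = x -> value (P, Q) x = Some a ->
    form_value d (form_subst d A Q) y != 0.
  move=> Ay /value_Some[b0 _]; have [c c0 [_ ->]] := valueE y.
  by rewrite Ay mulf_neq0 // -dE.
have Pinf : (form_subst d A P)`_d != 0.
  have [c c0 [/= -> _]] := valueE None; rewrite mulf_neq0 // Ainf -dE.
  have := form_value_neq0 x3 cop.
  by rewrite [X in _ || (X != 0)](value_None v3) eqxx orbF.
have sP' : size (form_subst d A P) = d.+1.
  apply/eqP; rewrite eqn_leq size_form_subst ltnNge.
  by apply: contraNN Pinf => /(nth_default 0) ->.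
have sQ' := has_order_inf (order_None _ _ _ Ainf r3 v3).
exists mu, (form_subst d A P), (form_subst d A Q); split.
  split=> //.
  - by apply: contraNneq n41 => m0; rewrite -Amu m0 A0.
  - by apply: contraNneq n42 => m0; rewrite -Amu m0 A1.
  - have := has_order_dvdp (order_Some _ _ _ _ A0 r1 v1).
    by rewrite subr0 scale0r subr0.
  - by have := has_order_dvdp (order_Some _ _ _ _ A1 r2 v2); rewrite scale1r.
  - exact: has_order_dvdp (order_Some _ _ _ _ Amu r4 v4).
  - exact: Q_neq0 _ _ _ A0 v1.
  - exact: Q_neq0 _ _ _ A1 v2.
exists A => // y.
have dE' : rdeg (form_subst d A P, form_subst d A Q) = d.
  by rewrite /rdeg /= sP' (maxn_idPl _) // -sQ' leq_addr.
rewrite /value !hom_valueE dE dE' /=; have [c c0 [-> ->]] := valueE y.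
by rewrite hom_pointZ.
Qed.

End Normalization.

(** * Irreducibility of a rational family *)

Section RationalFunctions.
Variables (k : fieldType) (D : {poly k}).

(** [phi] agrees, where [D] does not vanish, with a rational function whose
    denominator is a power of [D]. *)
Definition regular_off (phi : k -> k) : Prop := exists (N : {poly k}) (n : nat),
  forall mu, D.[mu] != 0 -> phi mu * D.[mu] ^+ n = N.[mu].

Lemma regular_off_poly (N : {poly k}) : regular_off (horner N).
Proof. by exists N, 0%N => mu _; rewrite mulr1. Qed.

Lemma regular_offD phi psi : regular_off phi -> regular_off psi ->
  regular_off (fun mu => phi mu + psi mu).
Proof.
move=> [N [n hN]] [M [m hM]]; exists (N * D ^+ m + M * D ^+ n), (n + m)%N => mu D0.
by rewrite hornerD !hornerM !horner_exp -hN // -hM // exprD; ring.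
Qed.

Lemma regular_offM phi psi : regular_off phi -> regular_off psi ->
  regular_off (fun mu => phi mu * psi mu).
Proof.
move=> [N [n hN]] [M [m hM]]; exists (N * M), (n + m)%N => mu D0.
by rewrite hornerM -hN // -hM // exprD; ring.
Qed.

Lemma regular_off_eq phi psi : phi =1 psi -> regular_off phi -> regular_off psi.
Proof. by move=> e [N [n hN]]; exists N, n => mu D0; rewrite -e hN. Qed.

Lemma regular_off_div (N : {poly k}) : regular_off (fun mu => N.[mu] / D.[mu]).
Proof. by exists N, 1%N => mu D0; rewrite expr1 divfK. Qed.

Lemma regular_off_meval n (v : k -> 'I_n -> k) (g : mpoly.mpoly n k) :
  (forall i, regular_off (fun mu => v mu i)) ->
  regular_off (fun mu => mpoly.meval (v mu) g).
Proof.
move=> hv; apply: (regular_off_eq (fun mu => esym (mpoly.mevalE (v mu) g))).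
elim: (mpoly.msupp g) => [|m s IHs].
  by apply: regular_off_eq (regular_off_poly 0) => mu; rewrite big_nil horner0.
apply: (regular_off_eq (fun mu => esym (big_cons _ _ _ _ _ _))).
apply: regular_offD IHs; apply: regular_offM.
  by apply: regular_off_eq (regular_off_poly (mpoly.mcoeff m g)%:P) => mu; rewrite hornerC.
elim: (index_enum _) => [|i r IHr].
  by apply: regular_off_eq (regular_off_poly 1) => mu; rewrite big_nil hornerE.
apply: (regular_off_eq (fun mu => esym (big_cons _ _ _ _ _ _))).
apply: regular_offM IHr; elim: (mpoly.fun_of_multinom m i) => [|j IHj].
  by apply: regular_off_eq (regular_off_poly 1) => mu; rewrite expr0 hornerE.
by apply: (regular_off_eq (fun mu => esym (exprS _ _))); apply: regular_offM.
Qed.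

End RationalFunctions.

(** Pulled back to the parameters, an open subset of the Hurwitz curve is the
    locus where some polynomial of a given set does not vanish. *)
Lemma open_hurwitz_curve (k : closedFieldType) d e (C : set (hurwitz_curve k d e)) :
  open C -> exists S : set (mpoly.mpoly (d.+1 + d.+1 + 1) k),
   forall v : set_type (@hurwitz_params k d e),
     C (\pi_(hurwitz_curve k d e) v)%qT <-> ~ zero_locus S (set_val v).
Proof.
move=> [U [S ->] UE]; exists S => v.
by have := congr1 (fun X => X v) UE; rewrite /= /preimage /= => ->.
Qed.

(** A Hurwitz curve all of whose points belong to one family with rational
    coordinates over a nonempty open subset of the line is connected: any two
    of its nonempty open subsets meet, being the images of sets that contain
    the complement of finitely many parameters. *)
Lemma connected_rational_family (k : closedFieldType) d e (D h : {poly k})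
    (v : k -> affine_space k (d.+1 + d.+1 + 1)) :
  h != 0 -> (forall mu, h.[mu] != 0 -> D.[mu] != 0) ->
  (forall i, regular_off D (fun mu => (v mu : 'rV[k]__) ord0 i)) ->
  (forall mu, h.[mu] != 0 -> @hurwitz_params k d e (v mu)) ->
  (forall x, @hurwitz_params k d e x -> exists2 mu, h.[mu] != 0 &
     isomorphic_covers (param_map (v mu)) (param_map x)) ->
  connected [set: hurwitz_curve k d e].
Proof.
move=> h0 hD vreg vpar vsurj B [b Bb] [C oC BC] [C' cC' BC'].
apply: contrapT => BT.
have [b' nb'] : exists b', ~ B b'.
  apply: contrapT => nex; apply: BT; apply/seteqP; split=> // x _.
  by apply: contrapT => nBx; apply: nex; exists x.
have {}BC : B = C by rewrite BC setTI.
have oC' : open (~` B) by rewrite BC' setTI; exact: closed_openC.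
have oB : open B by rewrite BC.
have point (x : hurwitz_curve k d e) : exists2 mu, h.[mu] != 0 &
    forall hm : @hurwitz_params k d e (v mu),
      \pi_(hurwitz_curve k d e)%qT (SigSub (mem_set hm) : set_type _) = x.
  have [mu hmu iso] := vsurj _ (set_valP (repr x)).
  exists mu => // hm; rewrite -[x in RHS]reprK.
  by apply/eqmodP; exact: (asboolT iso).
have witness (O : set (hurwitz_curve k d e)) x : open O -> O x ->
    exists G : {poly k}, G != 0 /\ forall mu (hm : @hurwitz_params k d e (v mu)),
      h.[mu] != 0 -> G.[mu] != 0 ->
      O (\pi_(hurwitz_curve k d e)%qT (SigSub (mem_set hm) : set_type _)).
  move=> /open_hurwitz_curve[S SE] Ox.
  have [mu0 hmu0 /(_ (vpar _ hmu0)) xE] := point x.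
  have [g Sg gmu0] : exists2 g, S g &
      mpoly.meval (fun i => (v mu0 : 'rV[k]__) ord0 i) g <> 0.
    apply: contrapT => nex; have : O x by []; rewrite -xE => /SE; apply => g Sg /=.
    by apply: contrapT => gv; apply: nex; exists g.
  have [G [n GE]] := regular_off_meval g vreg.
  exists G; split.
    apply: contraPneq gmu0 => G0; have := GE _ (hD _ hmu0).
    rewrite G0 horner0 => /eqP; rewrite mulf_eq0 expf_eq0 (negPf (hD _ hmu0)) andbF orbF.
    by move=> /eqP gv; apply.
  move=> mu hm hmu Gmu; apply/SE => /(_ g Sg) /= gmu.
  by move: Gmu; rewrite -GE ?hD // gmu mul0r eqxx.
have [G [G0 GE]] := witness _ _ oB Bb.
have [G' [G'0 GE']] := witness _ _ oC' nb'.
have [mu] := closed_nonrootP _ (mulf_neq0 h0 (mulf_neq0 G0 G'0)).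
rewrite rootE !hornerM !mulf_eq0 !negb_or => /and3P[hmu Gmu G'mu].
exact: GE' (vpar _ hmu) hmu G'mu (GE _ (vpar _ hmu) hmu Gmu).
Qed.

(** * The Hurwitz curve *)

Section Parametrization.
Variables (k : closedFieldType) (p : nat).
Hypotheses (p_prime : prime p) (p_odd : odd p) (char_k : p \in [pchar k]).
Variables (e1 e2 e3 d : nat).
Hypotheses (he1 : (1 < e1 < p)%N) (he2 : (1 < e2 < p)%N) (he3 : (1 < e3 < p)%N).
Hypothesis hd : (d.*2 + 3 = e1 + e2 + e3 + p)%N.

Lemma value_scale (c : k) (P Q : {poly k}) x : c != 0 ->
  value (c *: P, c *: Q) x = value (P, Q) x.
Proof.
move=> c0; rewrite /value !hom_valueE /= /rdeg /= !size_scale //.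
by case: x => [a|] /=; rewrite ?hornerZ ?coefZ hom_pointZ.
Qed.

(** The point of the parameter space given by a rational map and a branch
    point. *)
Definition hurwitz_point (f : ratmap k) (lam : k) : affine_space k (d.+1 + d.+1 + 1) :=
  row_mx (row_mx (poly_rV f.1 : 'rV[k]_d.+1) (poly_rV f.2 : 'rV[k]_d.+1)) (lam%:M : 'rV[k]_1).

Lemma param_map_point (f : ratmap k) lam :
  (size f.1 <= d.+1)%N -> (size f.2 <= d.+1)%N -> param_map (hurwitz_point f lam) = f.
Proof.
case: f => P Q s1 s2; rewrite /param_map /hurwitz_point row_mxKl row_mxKl row_mxKr.
by rewrite !poly_rV_K.
Qed.

Lemma param_lambda_point (f : ratmap k) lam : param_lambda (hurwitz_point f lam) = lam.
Proof. by rewrite /param_lambda /hurwitz_point row_mxKr mxE. Qed.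

Lemma connected_hurwitz_curve :
  connected [set: hurwitz_curve k d [tuple e1; e2; e3; p.-1]].
Proof.
have [[x0 x0P]|none] := pselect (exists x, @hurwitz_params k d [tuple e1; e2; e3; p.-1] x);
  last first.
  move=> B [b Bb] _ _; exfalso; apply: none.
  by exists (set_val (repr b)); exact: set_valP.
have e30 : (0 < e3)%N by case/andP: he3 => /ltnW.
have norm x : @hurwitz_params k d [tuple e1; e2; e3; p.-1] x ->
    exists mu P Q, normalized_cover p d e1 e2 e3 mu (param_lambda x) P Q /\
    exists2 A : 'M[k]_2, A \in unitmx &
      forall y, value (param_map x) (moebius A y) = value (P, Q) y.
  by move=> [l0 l1 rt]; apply: normalize_cover rt.
have [mu0 [P0 [Q0 [nc0 _]]]] := norm _ x0P.
have [u [w hb]] := hypergeom_basis_exists p_prime char_k he1 he2 he3 hd nc0.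
have [c c0 wr] := hypergeom_basis_wronskian p_prime char_k he1 he2 he3 hd nc0 hb.
rewrite /ramification_poly subr0 expr0 mulr1 in wr.
have [Bn BnE] := bezoutian_family ('X^p * u) w.
have [Bd BdE] := bezoutian_family u w.
have one mu : 1 = horner_eval mu (1 : {poly k}) by rewrite /horner_eval hornerE.
have n1E mu : (family_num p u w mu).[1] = (Bn.[1]).[mu].
  by rewrite /family_num BnE {1}(one mu) horner_map.
have d1E mu : (family_den u w mu).[1] = (Bd.[1]).[mu].
  by rewrite /family_den BdE {1}(one mu) horner_map.
pose h := 'X * ('X - 1%:P) * u * w * u.[1]%:P * Bn.[1] * Bd.[1].
have hE mu : (h.[mu] != 0) = admissible p u w mu.
  rewrite /h !hornerM hornerX hornerXsubC hornerC !mulf_eq0 !negb_or subr_eq0.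
  by rewrite /admissible n1E d1E !andbA.
pose v mu := hurwitz_point (family_map p u w mu) (family_lambda p u w mu).
have vmap mu : admissible p u w mu -> param_map (v mu) = family_map p u w mu.
  move=> adm; rewrite /v param_map_point //=.
    by rewrite (leq_trans (size_scale_leq _ _)) // (size_family_num he3 hb adm).
  by rewrite (leq_trans (size_scale_leq _ _)) // (size_family_den he3 hb adm) leq_subr.
have nc_adm mu lam P Q nc := @normalized_cover_in_family k p p_prime char_k
  e1 e2 e3 d he1 he2 he3 hd mu lam P Q nc u w hb.
apply: (@connected_rational_family _ _ _ Bn.[1] h v).
- apply/closed_nonrootP; exists mu0; rewrite rootE hE.
  by have [] := nc_adm _ _ _ _ nc0.
- by move=> mu; rewrite hE -n1E => /and5P[_ _ _ _ /and3P[]].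
- move=> i; rewrite /v /hurwitz_point /family_map /family_lambda.
  case: (split_ordP i) => j ->; last first.
    apply: regular_off_eq (regular_off_div Bn.[1] ('X^p * Bd.[1])) => mu.
    by rewrite row_mxEr (ord1 j) mxE mulr1n n1E d1E hornerM hornerXn.
  case: (split_ordP j) => l ->.
    apply: regular_off_eq (regular_off_poly Bn.[1] (Bd.[1] * Bn`_l)) => mu.
    by rewrite row_mxEl row_mxEl mxE /= coefZ d1E /family_num BnE coef_map hornerM.
  apply: regular_off_eq (regular_off_poly Bn.[1] (Bn.[1] * Bd`_l)) => mu.
  by rewrite row_mxEl row_mxEr mxE /= coefZ n1E /family_den BdE coef_map hornerM.
- move=> mu; rewrite hE => adm; rewrite /hurwitz_params /= vmap //.
  rewrite /v param_lambda_point; split.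
  + exact: family_lambda_neq0 adm.
  + exact: family_lambda_neq1 char_k _ _ _ adm.
  + exact: (family_ramification_type p_prime p_odd char_k he1 he2 he3 hb c0 wr adm).
- move=> x /norm[mu [P [Q [nc [A uA AE]]]]].
  have [adm [c' c'0 [PE QE]]] := nc_adm _ _ _ _ nc.
  exists mu; rewrite ?hE // vmap //; exists A => // y; rewrite AE PE QE.
  exact: value_scale.
Qed.

End Parametrization.

Theorem corollary3p4 (p : nat) (k : closedFieldType) (e1 e2 e3 : nat)
    (p_prime : prime p) (p_odd : odd p) (char_k : p \in [pchar k])
    (he1 : (1 < e1 < p)%N) (he2 : (1 < e2 < p)%N) (he3 : (1 < e3 < p)%N)
    (E_even : ~~ odd (e1 + e2 + e3)%N) (e3_neq : e3 <> p.-1) :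
  connected
    [set: hurwitz_curve k (e1 + e2 + e3 + p - 3)./2 [tuple e1; e2; e3; p.-1]].
Proof.
apply: (connected_hurwitz_curve p_prime p_odd char_k he1 he2 he3).
by clear -p_odd E_even he1 he2 he3; lia.
Qed.
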